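(* Let $M$ be a complete finite-dimensional Riemannian manifold with positive sectional curvature and let $\Omega\subseteq M$ be an open convex subset. Let $f:\Omega\to\mathbb{R}$ be continuous. Suppose that for every $x\in\Omega$ and every $(\xi,X)\in J^{2,+}f(x)$ one has $X\ge 0$ (that is, the symmetric bilinear form $X$ on $T_xM$ is positive semi-definite). Then $f$ is a convex function.
   Context: A subset $\Omega\subseteq M$ is convex if for all $x,y\in \Omega$ there exists a unique minimizing geodesic from $x$ to $y$ lying entirely in $\Omega$. A function $f:\Omega\to\mathbb{R}$ is convex if $f\circ\alpha$ is convex for every geodesic $\alpha$ in $\Omega$. The second order superjet of $f$ at $x$ is $$J^{2,+}f(x)=\{(d\varphi(x),d^2\varphi(x)) \mid \varphi\in C^2(U),\ f-\varphi \text{ attains a local maximum at } x\},$$ where $U$ is an open subset of $M$ containing the domain of $f$ and $d^2\varphi$ is the Riemannian Hessian, $d^2\varphi(v,w)=\langle\nabla_v\nabla\varphi,w\rangle$. *)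

(* Defs.v *)
From HB Require Import structures.
From mathcomp Require Import all_boot all_order all_algebra.
From mathcomp Require Import all_classical all_reals all_analysis.

Set Implicit Arguments.
Unset Strict Implicit.
Unset Printing Implicit Defensive.

Import Order.TTheory GRing.Theory Num.Theory.
Import numFieldNormedType.Exports.

Local Open Scope classical_set_scope.
Local Open Scope ring_scope.

Definition partial (R : realType) (n : nat) (V : normedModType R) (l : 'I_n)
    (f : 'rV[R]_n -> V) (p : 'rV[R]_n) : V := 'D_(delta_mx 0 l) f p.

(* Only the values of [f] on the open set [U] matter. *)
Fixpoint Ck (R : realType) (n : nat) (V : normedModType R) (k : nat)
    (U : set 'rV[R]_n) (f : 'rV[R]_n -> V) : Prop :=
  if k is k'.+1 then
    (forall y, U y -> differentiable f y) /\
    (forall l : 'I_n, Ck k' U (partial l f))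
  else forall y, U y -> {for y, continuous f}.

Definition smooth (R : realType) (n : nat) (V : normedModType R)
    (U : set 'rV[R]_n) (f : 'rV[R]_n -> V) : Prop := forall k, Ck k U f.

(* Smooth manifolds of dimension [n] (without boundary). The maps [cmap i] and
   [cinv i] are total, with junk values outside [cdom i] and its image. *)
Record smoothManifold (R : realType) (n : nat) := SmoothManifold {
  mcarrier :> topologicalType;
  m_hausdorff : hausdorff_space mcarrier;
  m_second_countable : @second_countable mcarrier;
  cindex : Type;
  cdom : cindex -> set mcarrier;
  cmap : cindex -> mcarrier -> 'rV[R]_n;
  cinv : cindex -> 'rV[R]_n -> mcarrier;
  cdom_open : forall i, open (cdom i);
  cimg_open : forall i, open (cmap i @` cdom i);
  cmapK : forall i x, cdom i x -> cinv i (cmap i x) = x;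
  cmap_continuous : forall i, {within cdom i, continuous (cmap i)};
  cinv_continuous : forall i, {within cmap i @` cdom i, continuous (cinv i)};
  chart_at : mcarrier -> cindex;
  chart_atP : forall x, cdom (chart_at x) x;
  transition_smooth : forall i j,
    smooth (cmap i @` (cdom i `&` cdom j)) (cmap j \o cinv i)
}.

Section Manifold.
Context {R : realType} {n : nat} {M : smoothManifold R n}.
Implicit Types (i j : cindex M) (x y : M).

Definition transition i j : 'rV[R]_n -> 'rV[R]_n := cmap j \o cinv i.

(* A tangent vector at [x]: its components in all the charts around [x], which
   correspond to each other under the differentials of the transition maps. *)
Record tangent (x : M) := Tangent {
  components : cindex M -> 'rV[R]_n;
  components_transition : forall i j, cdom i x -> cdom j x ->
    components j = 'D_(components i) (transition i j) (cmap i x)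
}.

Definition C2_on (U : set M) (phi : M -> R) : Prop :=
  forall i, Ck 2 (cmap i @` (cdom i `&` U)) (phi \o cinv i).

(* [c] is C^1 on an open neighbourhood of [J]. *)
Definition C1_curve (J : set R) (c : R -> M) : Prop :=
  exists O : set R, [/\ open O, J `<=` O,
    (forall t, O t -> {for t, continuous c}) &
    forall t i, O t -> cdom i (c t) ->
      derivable (cmap i \o c) t 1 /\
      {for t, continuous (derive1 (cmap i \o c))}].

(* Piecewise C^1 curves on [0, 1], with subdivision 0 = s_0 < s_1 < ... = 1. *)
Definition piecewise_C1 (c : R -> M) : Prop :=
  exists s : seq R, [/\ path <%R 0 s, last 0 s = 1 &
    forall k, (k < size s)%N -> exists b : R -> M,
      C1_curve `[nth 0 (0 :: s) k, nth 0 s k] b /\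
      {in `[nth 0 (0 :: s) k, nth 0 s k], c =1 b}].

End Manifold.

Definition bilin (R : realType) (n : nat) (G : 'M[R]_n) (v w : 'rV[R]_n) : R :=
  (v *m G *m w^T) 0 0.

(* [gmx i p] is the matrix of the metric in the chart [i], at the point of
   coordinates [p]. *)
Record riemannianManifold (R : realType) (n : nat) := RiemannianManifold {
  rbase :> smoothManifold R n;
  gmx : cindex rbase -> 'rV[R]_n -> 'M[R]_n;
  gmx_smooth : forall i, smooth (cmap i @` cdom i) (gmx i);
  gmx_sym : forall i x, cdom i x -> (gmx i (cmap i x))^T = gmx i (cmap i x);
  gmx_pos : forall i x v, cdom i x -> v != 0 ->
    0 < bilin (gmx i (cmap i x)) v v;
  gmx_transition : forall i j x v w, cdom i x -> cdom j x ->
    bilin (gmx i (cmap i x)) v w =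
    bilin (gmx j (cmap j x)) ('D_v (transition i j) (cmap i x))
                             ('D_w (transition i j) (cmap i x))
}.

Section Riemannian.
Context {R : realType} {n : nat} {M : riemannianManifold R n}.
Implicit Types (i : cindex M) (p v w : 'rV[R]_n) (x y : M).

(* Gamma^k_(ab) = 1/2 g^(kl) (d_a g_(bl) + d_b g_(al) - d_l g_(ab)). *)
Definition christoffel i p (k a b : 'I_n) : R :=
  2^-1 * \sum_l invmx (gmx i p) k l *
    (partial a (fun q => gmx i q b l) p + partial b (fun q => gmx i q a l) p
     - partial l (fun q => gmx i q a b) p).

Definition christoffel_bilin i p v w : 'rV[R]_n :=
  \row_k \sum_a \sum_b christoffel i p k a b * v 0 a * w 0 b.

(* The covariant derivative of the vector field with components [Y] in the
   direction [v], for the Levi-Civita connection. *)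
Definition nabla i v (Y : 'rV[R]_n -> 'rV[R]_n) p : 'rV[R]_n :=
  'D_v Y p + christoffel_bilin i p v (Y p).

Definition gradient i (psi : 'rV[R]_n -> R) p : 'rV[R]_n :=
  \row_k \sum_l invmx (gmx i p) k l * partial l psi p.

Definition hessian i (psi : 'rV[R]_n -> R) p v w : R :=
  bilin (gmx i p) (nabla i v (gradient i psi) p) w.

(* The vector fields with constant components u, v commute, whence no term in
   their bracket. *)
Definition curvature i p u v w : 'rV[R]_n :=
  nabla i u (nabla i v (cst w)) p - nabla i v (nabla i u (cst w)) p.

Definition sectional_curvature i p u v : R :=
  let g := bilin (gmx i p) in
  g (curvature i p u v v) u / (g u u * g v v - g u v ^+ 2).

Definition positive_sectional_curvature : Prop :=
  forall x i (u v : tangent x), cdom i x ->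
    row_free (col_mx (components u i) (components v i)) ->
    0 < sectional_curvature i (cmap i x) (components u i) (components v i).

Definition speed (c : R -> M) (t : R) : R :=
  let i := chart_at (c t) in
  let v := derive1 (cmap i \o c) t in
  Num.sqrt (bilin (gmx i (cmap i (c t))) v v).

Definition length (c : R -> M) : \bar R :=
  (\int[lebesgue_measure]_(t in `[0%R, 1%R]) (speed c t)%:E)%E.

Definition dist x y : \bar R :=
  ereal_inf [set length c | c in
    [set c : R -> M | [/\ piecewise_C1 c, c 0 = x & c 1 = y]]].

Definition complete_manifold : Prop :=
  forall u : nat -> M,
    (forall e : R, 0 < e -> exists N : nat, forall k l : nat,
       (N <= k)%N -> (N <= l)%N -> (dist (u k) (u l) < e%:E)%E) ->
    exists l : M, u @ \oo --> l.

(* [c] restricted to the interval [J] is a geodesic, affinely parametrized,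
   possibly constant. A geodesic defined on an interval which is not open
   always extends to a neighbourhood of it; [c] is taken to be so extended. *)
Definition geodesic (J : set R) (c : R -> M) : Prop :=
  exists O : set R, [/\ open O, J `<=` O,
    (forall t, O t -> {for t, continuous c}) &
    forall t i, O t -> cdom i (c t) ->
      let u := cmap i \o c in
      [/\ derivable u t 1, derivable (derive1 u) t 1 &
          derive1 (derive1 u) t +
             christoffel_bilin i (u t) (derive1 u t) (derive1 u t) = 0]].

Definition minimizing_geodesic x y (c : R -> M) : Prop :=
  [/\ geodesic `[0, 1] c, c 0 = x, c 1 = y & length c = dist x y].

(* Uniqueness is that of the restriction to [0, 1]. *)
Definition convex_subset (Om : set M) : Prop :=
  forall x y, Om x -> Om y ->
    let P c := minimizing_geodesic x y c /\ c @` `[0, 1] `<=` Om in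
    exists2 c, P c & forall c', P c' -> {in `[0, 1], c' =1 c}.

Definition convex_on (Om : set M) (f : M -> R) : Prop :=
  forall (J : set R) (c : R -> M), is_interval J -> geodesic J c ->
    c @` J `<=` Om -> convex_function (E := R^o) J (f \o c).

(* The differential and the Hessian of [phi] at [x], as forms on the tangent
   space; their values do not depend on the chart [i] around [x]. *)
Definition d1 i (phi : M -> R) x (v : tangent x) : R :=
  'D_(components v i) (phi \o cinv i) (cmap i x).

Definition d2 i (phi : M -> R) x (v w : tangent x) : R :=
  hessian i (phi \o cinv i) (cmap i x) (components v i) (components w i).

Definition superjet (Om : set M) (f : M -> R) (x : M) :
    set ((tangent x -> R) * (tangent x -> tangent x -> R)) :=
  [set j | exists (U : set M) (phi : M -> R) (i : cindex M),
    [/\ open U, Om `<=` U, C2_on U phi,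
        (\forall y \near x, Om y -> f y - phi y <= f x - phi x) &
        cdom i x /\ j = (d1 i phi (x := x), d2 i phi (x := x))]].

End Riemannian.

Arguments complete_manifold {R n} M.
Arguments positive_sectional_curvature {R n} M.

(* Main.v *)
Require Import Defs.
From mathcomp Require Import all_boot all_order all_algebra.
From mathcomp Require Import all_classical all_reals all_analysis.
From mathcomp Require Import ring lra.
Import Order.TTheory GRing.Theory Num.Theory.
Import numFieldNormedType.Exports.
Local Open Scope classical_set_scope.
Local Open Scope ring_scope.

(** The statement is local: at a point where [f] restricted to a geodesic fails
    to be convex, a test function contradicting the viscosity inequality is built
    inside one chart.

    If [g = f o c] is not convex, some strictly concave parabola [q] touches [g]
    from above, strictly, at an interior time [t0]
    ([parabola_above_chord_failure]). In a chart, let [u] be the geodesic, with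
    velocity [v]. When [v t0 = 0], the geodesic equation bounds the acceleration by
    the square of the speed, so [c] is constant near [t0]
    ([rest_of_quadratic_acceleration]), which no strictly concave parabola allows.

    When [v t0 <> 0], extend the parabola off the curve. The hyperplanes orthogonal
    to [v t0], for the Euclidean product of the chart, give a C^2 time coordinate [th] near [u t0] with [th (u t) = t]
    ([time_coordinate]); put [z p = p - u (th p)], so that [z] vanishes exactly on
    the curve, and [rho = |z|^2]. For [K] large enough the maximum over a small ball
    of [f - q o th - K rho] is attained close to [u t0], with [K rho] small
    ([penalization]). Let [p] be the maximum point, [s = th p], and test the Hessian
    of [Phi = q o th + K rho] on [w = v s]. The curve [t |-> p + u t - u s] has
    velocity [w] at [t = s], and [Phi] equals [q t + K |z p|^2] along it. Its
    acceleration is that of the geodesic at [u s], not at [p], hence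
    [Hess Phi (w, w) = q'' + dPhi (Gamma_(u s) (w, w) - Gamma_p (w, w))]
    ([second_derivative_along], [hessian_coordinates]). The Christoffel symbols are
    Lipschitz and [|dPhi| <= C (1 + K |z|)], so the second term is
    [O(|z| + K |z|^2)], which is small, while [q'' < 0]
    ([touching_geodesic]). A C^2 cut-off equal to 1 near [p] turns [Phi] into a
    function on the whole manifold, whose second order jet belongs to the superjet of
    [f] and is negative on [w] ([viscosity_in_chart]): a contradiction. *)

Set Implicit Arguments.
Unset Strict Implicit.
Unset Printing Implicit Defensive.

(** * Calculus of functions of class C^k on open subsets of R^n *)

Section CkCalculus.
Context {R : realType} {n : nat}.
Implicit Types (U : set 'rV[R]_n).

(** Differentials are chosen, not computed, hence the detour through uniqueness of
    the first order expansion. *)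
Lemma near_eq_differentiable (V W : normedModType R) (f g : V -> W) x :
  (\near x, f x = g x) -> differentiable f x -> differentiable g x.
Proof.
move=> fg df; have [dfc dfE] := (diff_locallyP x f).1 df.
have fgx : f x = g x := nbhs_singleton fg.
have gE : g \o shift x = cst (g x) + 'd f x +o_ 0 id.
  apply/eqaddoP => e e0; move/eqaddoP : dfE => /(_ e e0) dfE.
  have fg0 : \forall y \near (0 : V), f (y + x) = g (y + x).
    have := fg; rewrite (near_shift 0 x) /=; apply: filterS => y /=.
    by rewrite subr0.
  near=> y; rewrite -fgx /=.
  have -> : (g \o shift x - (cst (f x) + 'd f x)) y =
            (f \o shift x - (cst (f x) + 'd f x)) y.
    by rewrite !fctE /=; congr (_ - _); apply/esym; near: y.
  by near: y.
have E := diff_unique dfc gE.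
by apply/diff_locallyP; rewrite E.
Unshelve. all: by end_near. Qed.

Lemma open_near_eq (T : topologicalType) (S : Type) (U : set T) (f g : T -> S) x :
  open U -> (forall y, U y -> f y = g y) -> U x -> \near x, f x = g x.
Proof. by move=> oU fg Ux; near=> y; apply: fg; near: y; exact: open_nbhs_nbhs.
Unshelve. all: by end_near. Qed.

(** Functions built from charts carry arbitrary values outside the chart domains;
    this lets them be replaced there. *)
Lemma Ck_eq (V : normedModType R) k U (f g : 'rV[R]_n -> V) : open U ->
  (forall y, U y -> f y = g y) -> Ck k U f -> Ck k U g.
Proof.
move=> oU; elim: k f g => [|k IH] f g fg /=.
  move=> fc y Uy; apply: cvg_trans (near_eq_cvg (open_near_eq oU fg Uy)) _.
  by rewrite -fg //; exact: fc.
move=> [fd fp]; split=> [y Uy|l].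
  exact: near_eq_differentiable (open_near_eq oU fg Uy) (fd _ Uy).
apply: IH (fp l) => y Uy.
exact/near_eq_derive/(open_near_eq oU fg Uy).
Qed.

Lemma Ck_sub (V : normedModType R) k U U' (f : 'rV[R]_n -> V) :
  U' `<=` U -> Ck k U f -> Ck k U' f.
Proof.
move=> sU; elim: k f => [|k IH] f /=; first by move=> fc y /sU /fc.
by move=> [fd fp]; split=> [y /sU /fd //|l]; exact: IH.
Qed.

Lemma Ck_partial (V : normedModType R) k U (f : 'rV[R]_n -> V) l :
  Ck k.+1 U f -> Ck k U (partial l f).
Proof. by move=> [_ H]; exact: H. Qed.

Lemma Ck_differentiable (V : normedModType R) k U (f : 'rV[R]_n -> V) y :
  Ck k.+1 U f -> U y -> differentiable f y.
Proof. by case=> H _; exact: H. Qed.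

Lemma CkW (V : normedModType R) k U (f : 'rV[R]_n -> V) : Ck k.+1 U f -> Ck k U f.
Proof.
elim: k f => [|k IH] f [fd fp].
  by move=> y Uy; exact/differentiable_continuous/fd.
by split=> // l; exact/IH/fp.
Qed.

Lemma Ck_continuous (V : normedModType R) k U (f : 'rV[R]_n -> V) y :
  Ck k U f -> U y -> {for y, continuous f}.
Proof. by elim: k => [|k IH]; [exact|move=> /CkW /IH]. Qed.

Lemma Ck_cst (V : normedModType R) k U (a : V) : Ck k U (cst a).
Proof.
elim: k a => [|k IH] a /=; first by move=> y _; exact: cst_continuous.
split=> // l; suff -> : partial l (cst a) = cst 0 by exact: IH.
by apply/funext => y; rewrite /partial derive_cst.
Qed.

Lemma CkD (V : normedModType R) k U (f g : 'rV[R]_n -> V) : open U ->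
  Ck k U f -> Ck k U g -> Ck k U (f + g).
Proof.
move=> oU; elim: k f g => [|k IH] f g /=.
  by move=> fc gc y Uy; apply: continuousD; [exact: fc|exact: gc].
move=> [fd fp] [gd gp]; split=> [y Uy|l].
  by apply: differentiableD; [exact: fd|exact: gd].
apply: Ck_eq (IH _ _ (fp l) (gp l)) => // y Uy.
by rewrite /partial deriveD //; apply: diff_derivable; [exact: fd|exact: gd].
Qed.

Lemma CkM k U (f g : 'rV[R]_n -> R) : open U ->
  Ck k U f -> Ck k U g -> Ck k U (f * g).
Proof.
move=> oU; elim: k f g => [|k IH] f g Hf Hg /=.
  by move=> y Uy; apply: continuousM; [exact: Hf|exact: Hg].
have [[fd fp] [gd gp]] := (Hf, Hg); split=> [y Uy|l].
  by apply: differentiableM; [exact: fd|exact: gd].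
have := CkD oU (IH _ _ (CkW Hf) (gp l)) (IH _ _ (CkW Hg) (fp l)).
apply: Ck_eq => // y Uy; rewrite /partial deriveM //.
- by apply: diff_derivable; exact: fd.
- by apply: diff_derivable; exact: gd.
Qed.

Lemma CkN k U (f : 'rV[R]_n -> R) : open U -> Ck k U f -> Ck k U (- f).
Proof.
move=> oU Hf; have := CkM oU (Ck_cst k U (-1 : R)) Hf.
by apply: Ck_eq => // y Uy; rewrite !fctE mulN1r.
Qed.

Lemma CkB k U (f g : 'rV[R]_n -> R) : open U ->
  Ck k U f -> Ck k U g -> Ck k U (f - g).
Proof. by move=> oU Hf Hg; apply: CkD => //; exact: CkN. Qed.

Lemma Ck_sum k U (I : Type) (r : seq I) (P : pred I) (f : I -> 'rV[R]_n -> R) :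
  open U -> (forall i, P i -> Ck k U (f i)) ->
  Ck k U (fun p => \sum_(i <- r | P i) f i p).
Proof.
move=> oU Hf; rewrite (_ : (fun p => _) = \sum_(i <- r | P i) f i).
  by apply: big_rec => [|i g Pi]; [exact: Ck_cst|apply: CkD => //; exact: Hf].
by apply/funext => p; rewrite fct_sumE.
Qed.

Lemma Ck_prod k U (I : Type) (r : seq I) (P : pred I) (f : I -> 'rV[R]_n -> R) :
  open U -> (forall i, P i -> Ck k U (f i)) ->
  Ck k U (fun p => \prod_(i <- r | P i) f i p).
Proof.
move=> oU Hf; elim: r => [|i r IH].
  by under eq_fun do rewrite big_nil; exact: Ck_cst.
under eq_fun do rewrite big_cons.
by case Pi : (P i) => //; apply: (CkM oU (f := f i)) => //; exact: Hf.
Qed.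

Lemma CkV k U (f : 'rV[R]_n -> R) : open U -> (forall y, U y -> f y != 0) ->
  Ck k U f -> Ck k U (fun p => (f p)^-1).
Proof.
move=> oU f0; elim: k => [|k IH] Hf.
  by move=> y Uy; apply: continuousV; [exact: f0|exact: Hf].
have [fd fp] := Hf; have Hi := IH (CkW Hf); split=> [y Uy|l].
  by apply: differentiableV; [exact: fd|exact: f0].
have := CkN oU (CkM oU (CkM oU Hi Hi) (fp l)).
apply: Ck_eq => // y Uy; rewrite /partial deriveV ?f0 //; last exact/diff_derivable/fd.
by rewrite !fctE scaleNr /GRing.scale /= -exprVn expr2.
Qed.

Lemma derive_coord (V : normedModType R) m m' (A : V -> 'M[R]_(m, m')) a b x v :
  differentiable A x -> 'D_v (fun p => A p a b) x = ('D_v A x) a b.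
Proof. by move=> dA; rewrite derive_mx ?mxE //; exact: diff_derivable. Qed.

Lemma Ck_mx k U m m' (A : 'rV[R]_n -> 'M[R]_(m, m')) a b : open U ->
  Ck k U A -> Ck k U (fun p => A p a b).
Proof.
move=> oU; elim: k A => [|k IH] A /=.
  move=> Ac y Uy.
  apply: (@continuous_comp _ _ _ A (fun N : 'M[R]_(m, m') => N a b : R)).
    exact: Ac.
  exact: coord_continuous.
move=> [Ad Ap]; split=> [y Uy|l].
  apply: (@differentiable_comp _ _ _ _ A (fun N : 'M[R]_(m, m') => N a b : R)).
    exact: Ad.
  exact: differentiable_coord.
apply: Ck_eq (IH _ (Ap l)) => // y Uy.
by rewrite /partial derive_coord //; exact: Ad.
Qed.

Lemma Ck_coord k U (a : 'I_n) : open U -> Ck k U (fun p => p 0 a).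
Proof.
move=> oU; case: k => [|k]; first by move=> y _; exact: coord_continuous.
split=> [y _|l]; first exact: differentiable_coord.
apply: (Ck_eq oU _ (Ck_cst k U ((delta_mx 0 l : 'rV[R]_n) 0 a))) => y Uy.
rewrite /partial (derive_coord (A := id)) //.
by rewrite derive_id.
Qed.

(** Linearity of the differential; the derivatives along the basis vectors alone
    would not determine the others. *)
Lemma derive_partial (f : 'rV[R]_n -> R) p v : differentiable f p ->
  'D_v f p = \sum_l v 0 l * partial l f p.
Proof.
move=> df; rewrite deriveE // {1}(row_sum_delta v) linear_sum; apply: eq_bigr => l _.
by rewrite linearZ /partial deriveE.
Qed.

Lemma derive_comp (V V' W : normedModType R) (f : V -> V') (g : V' -> W) p v :
  differentiable f p -> differentiable g (f p) ->
  'D_v (g \o f) p = 'D_('D_v f p) g (f p).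
Proof.
move=> df dg; rewrite deriveE; last exact: differentiable_comp.
by rewrite diff_comp //= -!deriveE.
Qed.

End CkCalculus.

Lemma Ck_comp (R : realType) (n m : nat) k (U : set 'rV[R]_n) (U' : set 'rV[R]_m)
    (T : 'rV[R]_n -> 'rV[R]_m) (f : 'rV[R]_m -> R) : open U -> open U' ->
  (forall p, U p -> U' (T p)) -> Ck k U T -> Ck k U' f -> Ck k U (f \o T).
Proof.
move=> oU oU' TU; elim: k f => [|k IH] f HT Hf.
  by move=> y Uy; apply: continuous_comp; [exact: HT|exact/Hf/TU].
have [[Td Tp] [fd fp]] := (HT, Hf); split=> [y Uy|l].
  by apply: differentiable_comp; [exact: Td|exact/fd/TU].
have : Ck k U (fun p => \sum_(a < m) (partial l T p) 0 a * (partial a f \o T) p).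
  apply: Ck_sum => // a _.
  apply: (CkM oU (f := fun p => partial l T p 0 a)).
    exact: Ck_mx (Tp l).
  by apply: IH; [exact: CkW|exact: fp].
apply: Ck_eq => // y Uy; rewrite /partial (derive_comp _ (Td _ Uy) (fd _ (TU _ Uy))).
by rewrite derive_partial //; exact/fd/TU.
Qed.

Lemma Ck_union (R : realType) n (V : normedModType R) k (U1 U2 : set 'rV[R]_n)
    (f : 'rV[R]_n -> V) : Ck k U1 f -> Ck k U2 f -> Ck k (U1 `|` U2) f.
Proof.
elim: k f => [|k IH] f /=; first by move=> f1 f2 y [/f1|/f2].
by move=> [d1 p1] [d2 p2]; split=> [y [/d1|/d2]//|l]; exact: IH.
Qed.

(** * One-variable functions, the Euclidean square and cut-off functions *)

(** Class C^k on [O] for a function of one real variable. The derivatives are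
    existentially quantified because those of inverse functions and of solutions of
    the geodesic equation come with explicit formulas valid on [O] only. *)
Fixpoint derivative_tower (R : realType) (k : nat) (O : set R) (g : R -> R) : Prop :=
  if k is k'.+1 then
    exists2 g' : R -> R, (forall x, O x -> is_derive x 1 g (g' x)) &
      derivative_tower k' O g'
  else forall x, O x -> {for x, continuous g}.

Section Tower.
Context {R : realType}.
Implicit Types (O : set R) (g : R -> R).

Lemma is_derive1_differentiable g (x d : R) : is_derive x 1 g d -> differentiable g x.
Proof. by move=> [dg _]; exact/derivable1_diffP. Qed.

Lemma is_derive1_continuous g (x d : R) : is_derive x 1 g d -> {for x, continuous g}.
Proof. by move/is_derive1_differentiable/differentiable_continuous. Qed.

Lemma Ck_comp1 n k (U : set 'rV[R]_n) O (f : 'rV[R]_n -> R) g : open U ->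
  (forall p, U p -> O (f p)) -> Ck k U f -> derivative_tower k O g ->
  Ck k U (g \o f).
Proof.
move=> oU fO; elim: k g => [|k IH] g Hf Hg.
  by move=> y Uy; apply: continuous_comp; [exact: Hf|exact/Hg/fO].
have [fd fp] := Hf; have [g' dg Hg'] := Hg.
have dgf y : U y -> differentiable g (f y).
  by move=> Uy; apply: is_derive1_differentiable (dg _ (fO _ Uy)).
split=> [y Uy|l].
  by apply: differentiable_comp; [exact: fd|exact: dgf].
apply: Ck_eq (CkM oU (IH _ (CkW Hf) Hg') (fp l)) => // y Uy.
rewrite /partial (derive_comp _ (fd _ Uy) (dgf _ Uy)) !fctE /=.
rewrite [RHS]deriveE; last exact: dgf.
rewrite diff1E; last exact: dgf.
by rewrite /GRing.scale /= mulrC; case: (dg _ (fO _ Uy)) => _ <-; rewrite derive1E.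
Qed.

(** A truncated power of exponent [m] is of class C^(m-1): enough for C^2 cut-off
    functions, without the exponential. *)
Definition pospow (m : nat) (x : R) : R := Num.max 0 x ^+ m.

Lemma pospow_continuous m : continuous (pospow m).
Proof.
move=> x; apply: (@continuous_comp _ _ _ (fun x : R => Num.max 0 x) (fun y => y ^+ m)).
  by apply: continuous_max; [exact: cst_continuous|exact: cvg_id].
exact: exprn_continuous.
Qed.

(** Only the origin needs an argument: there, [pospow m.+2 z] is
    [pospow m.+1 z * z] and Caratheodory's criterion applies. *)
Lemma is_derive_pospow m (x : R) :
  is_derive x 1 (pospow m.+2) (m.+2%:R * pospow m.+1 x).
Proof.
have [x0|x0|->] := ltgtP x 0.
- rewrite /pospow (max_idPl (ltW x0)) expr0n /= mulr0.
  apply: near_eq_is_derive (is_derive_cst (0 : R) x 1).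
  near=> y; have y0 : y < 0 by near: y; exact: lt_nbhsl.
  by rewrite (max_idPl (ltW y0)) expr0n.
- rewrite {2}/pospow (max_idPr (ltW x0)).
  apply: (@near_eq_is_derive _ _ _ (id ^+ m.+2 : R -> R)).
    near=> y; have y0 : 0 < y by near: y; exact: lt_nbhsr.
    by rewrite /pospow (max_idPr (ltW y0)) exprfctE.
  apply: (is_derive_eq (is_deriveX m.+2 (is_derive_id x (1 : R)))).
  by rewrite /GRing.scale /= mulr1.
- apply/is_derive1_caratheodory; exists (pospow m.+1); split=> [z||].
  + rewrite /pospow maxxx !expr0n /= !subr0.
    by case: (leP 0 z) => z0; rewrite ?expr0n /= ?mul0r // [in LHS]exprSr.
  + exact: pospow_continuous.
  + by rewrite /pospow maxxx expr0n /= mulr0.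
Unshelve. all: by end_near. Qed.

Lemma derivative_tower_pospow O : derivative_tower 2 O (pospow 3).
Proof.
exists (fun x => 3%:R * pospow 2 x); first by move=> x _; exact: is_derive_pospow.
exists (fun x => 3%:R * (2%:R * pospow 1 x)) => [x _|x _ /=].
  have := is_derive_pospow 0 x => H.
  by apply: is_derive_eq.
apply: continuousM; first exact: cst_continuous.
by apply: continuousM; [exact: cst_continuous|exact: pospow_continuous].
Qed.

End Tower.

Definition sqn (R : realType) (n : nat) (y : 'rV[R]_n) : R :=
  \sum_k y 0 k ^+ 2.

Section SquaredNorm.
Context {R : realType} {n : nat}.
Implicit Types (p q y : 'rV[R]_n).

Lemma sqn_ge0 y : 0 <= sqn y.
Proof. by apply: sumr_ge0 => k _; exact: sqr_ge0. Qed.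

Lemma coord_norm_le y k : `|y 0 k| <= `|y|.
Proof.
rewrite [leRHS]/Num.Def.normr /= mx_normrE.
exact: (@le_bigmax _ _ _ 0 (fun i : 'I_1 * 'I_n => `|y i.1 i.2|) (0, k)).
Qed.

Lemma row_norm_le (v : 'rV[R]_n) (C : R) : 0 <= C -> (forall k, `|v 0 k| <= C) -> `|v| <= C.
Proof.
move=> C0 vC; rewrite [leLHS]/Num.Def.normr /= mx_normrE.
by apply: bigmax_le => // -[a k] _; rewrite /= (ord1 a).
Qed.

Lemma norm_le_sqn y : `|y| ^+ 2 <= sqn y.
Proof.
have [->|y0] := eqVneq `|y| 0; first by rewrite expr0n sqn_ge0.
have [[i k] /= e] := mx_norm_neq0 y0.
have -> : `|y| = `|y 0 k| by move: e; rewrite (ord1 i).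
rewrite real_normK ?num_real // /sqn (bigD1 k) //= lerDl.
by apply: sumr_ge0 => j _; exact: sqr_ge0.
Qed.

Lemma sqn0 : sqn (0 : 'rV[R]_n) = 0.
Proof. by rewrite /sqn big1 // => k _; rewrite mxE expr0n. Qed.

Lemma sqn_eq0 y : sqn y = 0 -> y = 0.
Proof.
move=> y0; apply/eqP; rewrite -normr_eq0 -sqrf_eq0; apply/eqP/le_anti.
by rewrite sqr_ge0 andbT -y0 norm_le_sqn.
Qed.

Lemma sqn_gt0 y : y != 0 -> 0 < sqn y.
Proof.
by move=> y0; rewrite lt_neqAle sqn_ge0 andbT eq_sym; apply: contra_neq y0 => /sqn_eq0.
Qed.

Lemma Ck_sqn k U (y : 'I_n -> 'rV[R]_n -> R) : open U ->
  (forall a, Ck k U (y a)) -> Ck k U (fun p => \sum_a y a p ^+ 2).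
Proof.
by move=> oU Hy; apply: Ck_sum => // a _; apply: (CkM oU (Hy a) (Hy a)).
Qed.

(** With [h x = max(0, x)^3], the function [h (r^2 - |q - p|^2)] has the right
    support; applying [h] once more, to an affine function of it, flattens it near
    [p]. *)
Lemma bump_exists p (r : R) : 0 < r -> exists B : 'rV[R]_n -> R,
  [/\ Ck 2 setT B, \near p, B p = 1 & forall q, r <= `|q - p| -> B q = 0].
Proof.
move=> r0; have oT : open [set: 'rV[R]_n] := openT.
pose d q := \sum_a (q 0 a - p 0 a) ^+ 2.
have dE q : d q = sqn (q - p) by apply: eq_bigr => a _; rewrite !mxE.
have Hd : Ck 2 setT d.
  apply: (Ck_sqn (y := fun a q => q 0 a - p 0 a)) => // a.
  by apply: (CkB oT); [exact: Ck_coord|exact: Ck_cst].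
pose h := @pospow R 3.
(* With this value, [c * h (r^2 - |q - p|^2) >= 1] as soon as [|q - p|^2 <= r^2 / 2],
   because [h (r^2 / 2) = r^6 / 8]. *)
pose c : R := 8 / (r ^+ 2) ^+ 3.
have c0 : 0 < c by rewrite divr_gt0 // !exprn_gt0.
exists (fun q => 1 - h (1 - c * h (r ^+ 2 - d q))); split.
- have Hh (f : 'rV[R]_n -> R) : Ck 2 setT f -> Ck 2 setT (h \o f).
    move=> Hf; apply: (@Ck_comp1 R n 2 setT setT f h oT) => //.
    exact: derivative_tower_pospow.
  apply: (CkB oT); first exact: Ck_cst.
  apply: (Hh (fun q => 1 - c * h (r ^+ 2 - d q))).
  apply: (CkB oT); first exact: Ck_cst.
  apply: (CkM oT); first exact: Ck_cst.
  apply: (Hh (fun q => r ^+ 2 - d q)).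
  by apply: (CkB oT); first exact: Ck_cst.
- have dp : d p < r ^+ 2 / 2 by rewrite dE subrr sqn0 divr_gt0 // exprn_gt0.
  near=> q; have dq : d q < r ^+ 2 / 2.
    near: q; apply: cvgr_lt dp.
    exact: (Ck_continuous Hd (y := p)).
  have q2 : (r ^+ 2 / 2) ^+ 3 <= h (r ^+ 2 - d q).
    rewrite /h /pospow lerXn2r ?nnegrE //.
    + by rewrite ltW // divr_gt0 // exprn_gt0.
    + by rewrite le_max lexx.
    + by rewrite le_max; apply/orP; right; lra.
  have : 1 <= c * h (r ^+ 2 - d q).
    apply: le_trans (ler_wpM2l (ltW c0) q2).
    rewrite /c expr_div_n; have rn : r != 0 by rewrite gt_eqF.
    by rewrite le_eqVlt; apply/orP; left; apply/eqP; field.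
  move=> ge1; rewrite {1}/h /pospow (max_idPl _) ?expr0n /= ?subr0 //; lra.
- move=> q rq; have : r ^+ 2 <= d q.
    rewrite dE; apply: le_trans (norm_le_sqn _).
    by rewrite lerXn2r ?nnegrE // ltW.
  move=> rd; rewrite {2}/h /pospow (max_idPl _) ?expr0n /=; last lra.
  rewrite mulr0 subr0 /h /pospow (max_idPr _) ?expr1n ?subrr //.
Unshelve. all: by end_near. Qed.

End SquaredNorm.

(** * Convexity on an interval and inverse functions *)

Section Convexity1D.
Context {R : realType}.
Implicit Types (g : R -> R) (J : set R).

(** Add a small multiple of [(t - x) (t - y)] to the excess of [g] over its chord:
    it still vanishes at the end points and is positive at [z], so its maximum
    [t0] is interior, and comparing with the value at [t0] gives the parabola. *)
Lemma parabola_above_chord_failure g (x y z : R) : x < z -> z < y ->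
  (forall t, x <= t <= y -> {for t, continuous g}) ->
  g x + (g y - g x) / (y - x) * (z - x) < g z ->
  exists t0 b e : R, [/\ x < t0 < y, 0 < e & forall t, x <= t <= y ->
    g t - g t0 <= b * (t - t0) - e * (t - t0) ^+ 2].
Proof.
move=> xz zy gc gz; have xy := lt_trans xz zy.
set s := (g y - g x) / (y - x) in gz.
(* Half of the coefficient which would cancel the excess of [g] over the chord at [z]. *)
pose e := (g z - (g x + s * (z - x))) / ((z - x) * (y - z)) / 2.
have den0 : 0 < (z - x) * (y - z) by rewrite mulr_gt0 ?subr_gt0.
have e0 : 0 < e by rewrite !divr_gt0 // subr_gt0.
pose H t := g t - (g x + s * (t - x)) + e * ((t - x) * (t - y)).
have Hc : {within `[x, y], continuous H}.
  apply: continuous_in_subspaceT => t; rewrite inE /= in_itv /= => xty.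
  apply: cvgD.
    apply: cvgB; first exact: gc.
    apply: cvgD; first exact: cvg_cst.
    by apply: cvgM; [exact: cvg_cst|apply: cvgB; [exact: cvg_id|exact: cvg_cst]].
  apply: cvgM; first exact: cvg_cst.
  by apply: cvgM; apply: cvgB; [exact: cvg_id|exact: cvg_cst|exact: cvg_id|exact: cvg_cst].
have [c] := EVT_max (ltW xy) Hc; rewrite in_itv /= => xcy Hmax.
have sy : s * (y - x) = g y - g x by rewrite /s divfK // subr_eq0 gt_eqF.
have ez : e * ((z - x) * (y - z)) = (g z - (g x + s * (z - x))) / 2.
  by rewrite /e mulrAC divfK // gt_eqF.
have Hz : 0 < H z.
  have -> : H z = (g z - (g x + s * (z - x))) / 2 by rewrite -ez /H -[z - y]opprB; lra.
  by rewrite divr_gt0 // subr_gt0.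
have zc : H z <= H c by apply: Hmax; rewrite in_itv /= !ltW.
have Hx : H x = 0 by rewrite /H !subrr; ring.
have Hy : H y = 0 by rewrite /H sy subrr; ring.
exists c, (s - e * (c + c - x - y)), e; split=> //.
  case/andP: xcy; rewrite !le_eqVlt => /orP[/eqP cx|xc] /orP[/eqP cy|cy].
  - by move: zc; rewrite -cx Hx; lra.
  - by move: zc; rewrite -cx Hx; lra.
  - by move: zc; rewrite cy Hy; lra.
  - by rewrite xc cy.
move=> t xty; have : H t <= H c by apply: Hmax; rewrite in_itv.
by rewrite /H; lra.
Qed.

(** The one-dimensional form of the viscosity criterion. *)
Lemma convex_of_no_parabola g J : is_interval J ->
  (forall t, J t -> {for t, continuous g}) ->
  (forall x y t0 b e : R, x < t0 < y -> 0 < e ->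
     (forall t, x <= t <= y -> J t /\ g t - g t0 <= b * (t - t0) - e * (t - t0) ^+ 2) ->
     False) ->
  convex_function (E := R^o) J g.
Proof.
move=> iJ gc noparab.
have chord x y z : J x -> J y -> x < z -> z < y ->
    g z <= g x + (g y - g x) / (y - x) * (z - x).
  move=> Jx Jy xz zy; rewrite leNgt; apply/negP => gz.
  have Jxy t : x <= t <= y -> J t by exact: (iJ _ _ Jx Jy).
  have [t|t0 [b [e [xt0y e0 H]]]] := parabola_above_chord_failure xz zy _ gz.
    by move=> /Jxy /gc.
  by apply: (noparab _ _ _ _ _ xt0y e0) => t xty; split; [exact: Jxy|exact: H].
move=> l x y; rewrite !inE => Jx Jy.
have [l0|l0] := eqVneq l%:num 0.
  have -> : l = 0%:i01 by apply/val_inj.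
  by rewrite !conv0.
have [l1|l1] := eqVneq l%:num 1.
  have -> : l = 1%:i01 by apply/val_inj.
  by rewrite !conv1.
have {}l0 : 0 < l%:num by rewrite lt_neqAle eq_sym l0 ge0.
have {}l1 : l%:num < 1 by rewrite lt_neqAle l1 le1.
rewrite [leRHS](_ : _ = l%:num * g x + (1 - l%:num) * g y) //.
set z : R := conv l x y.
have zE : z = l%:num * x + (1 - l%:num) * y by [].
have [xy|yx|xy] := ltgtP (x : R) y.
- have zx : z - x = (1 - l%:num) * (y - x) by rewrite zE; ring.
  have yz : y - z = l%:num * (y - x) by rewrite zE; ring.
  have := chord x y z Jx Jy; rewrite -(subr_gt0 x) -(subr_gt0 z) zx yz.
  have xy0 : 0 < y - x by rewrite subr_gt0.
  have ll : 0 < 1 - l%:num by rewrite subr_gt0.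
  move=> /(_ (mulr_gt0 ll xy0) (mulr_gt0 l0 xy0)) /le_trans; apply.
  rewrite mulrCA divfK ?gt_eqF //.
  by rewrite le_eqVlt; apply/orP; left; apply/eqP; ring.
- have zy : z - y = l%:num * (x - y) by rewrite zE; ring.
  have xz : x - z = (1 - l%:num) * (x - y) by rewrite zE; ring.
  have := chord y x z Jy Jx; rewrite -(subr_gt0 y) -(subr_gt0 z) zy xz.
  have xy0 : 0 < x - y by rewrite subr_gt0.
  have ll : 0 < 1 - l%:num by rewrite subr_gt0.
  move=> /(_ (mulr_gt0 l0 xy0) (mulr_gt0 ll xy0)) /le_trans; apply.
  rewrite mulrCA divfK ?gt_eqF //.
  by rewrite le_eqVlt; apply/orP; left; apply/eqP; ring.
- have -> : z = x by rewrite zE -xy; ring.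
  by rewrite -xy le_eqVlt; apply/orP; left; apply/eqP; ring.
Qed.

Lemma no_constant_touching (g : R -> R) (t0 d b e : R) : 0 < d -> 0 < e ->
  (forall t, `|t - t0| <= d -> g t = g t0 /\ g t - g t0 <= b * (t - t0) - e * (t - t0) ^+ 2) ->
  False.
Proof.
move=> d0 e0 H.
have Hp : `|t0 + d - t0| <= d by rewrite addrC addKr gtr0_norm.
have Hm : `|t0 - d - t0| <= d by rewrite addrC addKr normrN gtr0_norm.
have [Ep Lp] := H _ Hp; have [Em Lm] := H _ Hm.
have : 0 < e * d ^+ 2 by rewrite mulr_gt0 // exprn_gt0.
move: Lp Lm; rewrite Ep Em subrr.
rewrite (_ : t0 + d - t0 = d); last by ring.
rewrite (_ : t0 - d - t0 = - d); last by ring.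
by rewrite sqrrN mulrN; lra.
Qed.

(** Twice differentiating [s (tau y) = y] gives [tau' = 1 / s1 (tau)] and the
    derivative of that quotient. The set [O] is the image of a slightly smaller
    interval, so that the intermediate value theorem applies on a segment. *)
Lemma inverse_derivative_tower (a b t0 : R) (s s1 s2 : R -> R) : a < t0 < b ->
  (forall t, a < t < b -> is_derive t 1 s (s1 t)) ->
  (forall t, a < t < b -> is_derive t 1 s1 (s2 t)) ->
  (forall t, a < t < b -> {for t, continuous s2}) ->
  (forall t, a < t < b -> 0 < s1 t) ->
  exists (O : set R) (tau : R -> R), [/\ open O, O (s t0),
    forall y, O y -> a < tau y < b /\ s (tau y) = y,
    forall t, a < t < b -> O (s t) -> tau (s t) = t &
    derivative_tower 2 O tau].
Proof.
move=> /andP[at0 t0b] ds ds1 cs2 s1_gt0.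
have sc t : a < t < b -> {for t, continuous s} by move=> /ds /is_derive1_continuous.
have incr t t' : a < t -> t' < b -> t < t' -> s t < s t'.
  move=> at_ t'b tt'.
  have itv x : x \in `[t, t'] -> a < x < b.
    by rewrite in_itv /= => /andP[tx xt']; rewrite (lt_le_trans at_ tx) (le_lt_trans xt' t'b).
  have [||x] := MVT (f := s) (df := s1) tt'.
  - by move=> x xtt'; apply/ds/itv; rewrite in_itv /= !ltW ?(itvP xtt').
  - by apply: continuous_in_subspaceT => x; rewrite inE => /itv /sc.
  - move=> xtt' E; rewrite -subr_gt0 E mulr_gt0 ?subr_gt0 //.
    by apply/s1_gt0/itv; rewrite in_itv /= !ltW ?(itvP xtt').
have inj t t' : a < t < b -> a < t' < b -> s t = s t' -> t = t'.
  move=> /andP[a1 b1] /andP[a2 b2] E.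
  have [tt'|t't|//] := ltgtP t t'.
    by have := incr _ _ a1 b2 tt'; rewrite E ltxx.
  by have := incr _ _ a2 b1 t't; rewrite E ltxx.
pose a' := (a + t0) / 2; pose b' := (t0 + b) / 2.
have aa' : a < a' by rewrite /a'; lra.
have a't0 : a' < t0 by rewrite /a'; lra.
have t0b' : t0 < b' by rewrite /b'; lra.
have b'b : b' < b by rewrite /b'; lra.
pose O := [set` `]s a', s b'[ ].
have surj y : O y -> exists t, a < t < b /\ s t = y.
  rewrite /O /= in_itv /= => /andP[y1 y2].
  have [||x] := @IVT R s a' b' y (ltW (lt_trans a't0 t0b')).
  - apply: continuous_in_subspaceT => x; rewrite inE /= in_itv /= => /andP[x1 x2].
    by apply: sc; rewrite (lt_le_trans aa' x1) (le_lt_trans x2 b'b).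
  - by rewrite ge_min le_max (ltW y1) (ltW y2) orbT.
  - rewrite in_itv /= => /andP[x1 x2] E; exists x; split=> //.
    by rewrite (lt_le_trans aa' x1) (le_lt_trans x2 b'b).
pose tau y := xget t0 [set t | a < t < b /\ s t = y].
have tauP y : O y -> a < tau y < b /\ s (tau y) = y.
  by move=> /surj; exact: (@xgetPex _ t0 [set t | a < t < b /\ s t = y]).
have tauK t : a < t < b -> O (s t) -> tau (s t) = t.
  by move=> Ht /tauP [Htau E]; exact: inj.
have oO : open O by exact: interval_open.
exists O, tau; split=> //.
  by rewrite /O /= in_itv /=; apply/andP; split; apply: incr.
have itv_nbhs t : a < t < b -> \near t, a < t < b.
  move=> /andP[at_ tb]; near=> x; apply/andP; split; near: x.
    exact: lt_nbhsr.
  exact: lt_nbhsl.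
have dtau y : O y -> is_derive y 1 tau (s1 (tau y))^-1.
  move=> Oy; have [Ht E] := tauP y Oy; rewrite -{1}E.
  apply: (@is_derive_inverse _ s); last by rewrite gt_eqF // s1_gt0.
  - near=> t; apply: tauK; first by near: t; exact: itv_nbhs.
    near: t; apply: (sc _ Ht); rewrite E; exact: open_nbhs_nbhs.
  - near=> t; apply: sc; near: t; exact: itv_nbhs.
  - exact: ds.
have ctau y : O y -> {for y, continuous tau} by move=> /dtau /is_derive1_continuous.
exists (fun y => (s1 (tau y))^-1) => //.
exists (fun y => - (s1 (tau y)) ^- 2 * (s2 (tau y) * (s1 (tau y))^-1)) => y Oy.
  have [Ht _] := tauP y Oy; have n0 : s1 (tau y) != 0 by rewrite gt_eqF // s1_gt0.
  have Hd := is_derive1_comp (ds1 _ Ht) (dtau _ Oy).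
  by have := is_deriveV n0 Hd.
have [Ht _] := tauP y Oy; have n0 : s1 (tau y) != 0 by rewrite gt_eqF // s1_gt0.
have c1 : {for y, continuous (s1 \o tau)}.
  by apply: continuous_comp; [exact: ctau|exact/is_derive1_continuous/ds1].
have c2 : {for y, continuous (s2 \o tau)}.
  by apply: continuous_comp; [exact: ctau|exact: cs2].
apply: cvgM; last by apply: cvgM; [exact: c2|apply: cvgV].
apply: cvgN; apply: cvgV; first by rewrite expf_neq0.
by under eq_fun do rewrite expr2; apply: cvgM.
Unshelve. all: by end_near. Qed.

End Convexity1D.

(** * Mean value estimates *)

Section MeanValue.
Context {R : realType}.

Lemma mean_value_between (f df : R -> R) (s t : R) :
  (forall x, Num.min s t <= x <= Num.max s t -> is_derive x 1 f (df x)) ->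
  exists2 c, Num.min s t <= c <= Num.max s t & f t - f s = df c * (t - s).
Proof.
wlog st : s t / s <= t => [H|] dfx.
  have /orP[st|ts] := le_total s t; first exact: H.
  have [|c cts E] := H t s ts; first by rewrite minC maxC.
  by exists c; [rewrite minC maxC|rewrite -[LHS]opprB E; ring].
rewrite (min_idPl st) (max_idPr st) in dfx *.
have [||c] := MVT_segment (f := f) (df := df) st.
- by move=> x /andP[sx xt]; apply: dfx; rewrite !bnd_simp in sx xt; rewrite !ltW.
- apply: continuous_in_subspaceT => x; rewrite inE /= in_itv /= => /dfx.
  exact: is_derive1_continuous.
- by rewrite in_itv /=; exists c.
Qed.

Lemma between_dist_le (c s t t0 d : R) : Num.min s t <= c <= Num.max s t ->
  `|s - t0| <= d -> `|t - t0| <= d -> `|c - t0| <= d.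
Proof. by rewrite ge_min le_max !ler_distl; lra. Qed.

Lemma is_derive_mxE (V : normedModType R) m m' (A : V -> 'M[R]_(m, m')) B x v a b :
  is_derive x v A B -> is_derive x v (fun t => A t a b) (B a b).
Proof.
move=> [dA <-]; rewrite derive_mx // mxE; apply: derivableP.
exact: ((derivable_mxP A x v).1 dA a b).
Qed.

Lemma is_derive_curve (V W : normedModType R) (g : R -> V) (f : V -> W) (x : R) w :
  is_derive x 1 g w -> differentiable f (g x) ->
  is_derive x 1 (f \o g) ('D_w f (g x)).
Proof.
move=> [/derivable1_diffP dg <-] df; rewrite -derive_comp //.
by apply/derivableP/derivable1_diffP; exact: differentiable_comp.
Qed.

Lemma is_derive_line (V : normedModType R) (q w : V) (x : R) :
  is_derive x 1 (fun t => q + t *: w) w.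
Proof.
rewrite -[X in is_derive _ _ _ X]add0r; apply: is_deriveD.
apply: DeriveDef; first by apply/derivable1_diffP.
by rewrite deriveE // diff_val scale1r.
Qed.

Lemma is_derive_vec_continuous (V : normedModType R) (v : R -> V) (t : R) a :
  is_derive t 1 v a -> {for t, continuous v}.
Proof. by move=> [dv _]; apply: differentiable_continuous; exact/derivable1_diffP. Qed.

Context {n : nat}.

Lemma row_continuous (T : topologicalType) (f : T -> 'rV[R]_n) (x : T) :
  (forall k, {for x, continuous (fun t => f t 0 k)}) -> {for x, continuous f}.
Proof.
move=> fc; apply/cvgrPdist_le => e e0; near=> t.
rewrite [leLHS]/Num.Def.normr /= mx_normrE.
apply: bigmax_le => [|[i k] _]; first exact: ltW.
rewrite !mxE /= (ord1 i); move: k; near: t; apply: filter_forall => k.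
exact: ((cvgrPdist_le _ _).1 (fc k)).
Unshelve. all: by end_near. Qed.

Lemma sum_continuous (T : topologicalType) (m : nat) (f : 'I_m -> T -> R) (x : T) :
  (forall k, {for x, continuous (f k)}) -> {for x, continuous (fun t => \sum_k f k t)}.
Proof.
move=> fc; rewrite (_ : (fun t => _) = \sum_k f k); last by apply/funext => t; rewrite fct_sumE.
by elim/big_ind : _ => [|g h gc hc|k _]; [exact: cst_continuous|exact: cvgD|exact: fc].
Qed.

Lemma constant_of_zero_velocity (u v : R -> 'rV[R]_n) (t0 d : R) : 0 < d ->
  (forall t, `|t - t0| <= d -> is_derive t 1 u (v t)) ->
  (forall t, `|t - t0| <= d -> v t = 0) ->
  forall t, `|t - t0| <= d -> u t = u t0.
Proof.
move=> d0 du v0 t td; apply/rowP => k; apply/eqP; rewrite -subr_eq0; apply/eqP.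
have t0d : `|t0 - t0| <= d by rewrite subrr normr0 ltW.
have [x Hx|c Hc ->] := @mean_value_between (fun x => u x 0 k) (fun x => v x 0 k) t0 t.
  by apply/is_derive_mxE/du; exact: between_dist_le Hx _ _.
by rewrite v0 ?mxE ?mul0r //; exact: between_dist_le Hc _ _.
Qed.

(** On a short interval around [t0], the maximal speed [m] satisfies
    [m <= d' C m^2 <= m / 2] by the mean value theorem, once [m <= 1] and
    [d' C <= 1 / 2]: so it vanishes. For geodesics this replaces the uniqueness of
    solutions of the geodesic equation. *)
Lemma rest_of_quadratic_acceleration (v a : R -> 'rV[R]_n) (t0 d C : R) : 0 < d ->
  (forall t, `|t - t0| <= d -> is_derive t 1 v (a t)) ->
  (forall t, `|t - t0| <= d -> `|a t| <= C * `|v t| ^+ 2) ->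
  v t0 = 0 ->
  exists2 d' : R, 0 < d' <= d & forall t, `|t - t0| <= d' -> v t = 0.
Proof.
move=> d0 dv av v0.
have t0d : `|t0 - t0| <= d by rewrite subrr normr0 ltW.
have cv t : `|t - t0| <= d -> {for t, continuous (fun t => `|v t|)}.
  move=> /dv /is_derive_vec_continuous cvt.
  by apply: continuous_comp; [exact: cvt|exact: norm_continuous].
have : \near t0, `|v t0| < 1.
  by apply: (cvgr_lt _ (cv _ t0d)); rewrite v0 normr0.
move=> /nbhs_ballP[d1 /= d10 Hd1].
pose C' := Num.max C 1.
have C'0 : 0 < C' by rewrite lt_max ltr01 orbT.
pose d' := Num.min (Num.min d (d1 / 2)) (C'^-1 / 2).
have d'0 : 0 < d' by rewrite !lt_min d0 !divr_gt0 ?invr_gt0.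
have d'd : d' <= d by rewrite !ge_min lexx.
have d'd1 : d' < d1.
  apply: (@le_lt_trans _ _ (d1 / 2)); first by rewrite !ge_min lexx orbT.
  by move: d10; lra.
have d'C : C' * d' <= 1 / 2.
  have : d' <= C'^-1 / 2 by rewrite !ge_min lexx orbT.
  by move=> /(ler_wpM2l (ltW C'0)); rewrite mulrA divff ?gt_eqF.
have itvE t : (t \in `[t0 - d', t0 + d']) = (`|t - t0| <= d').
  by rewrite in_itv /= ler_distl.
have [||s] := @EVT_max R (fun t => `|v t|) (t0 - d') (t0 + d').
- by lra.
- apply: continuous_in_subspaceT => t; rewrite inE /= itvE => td.
  by apply: cv; exact: le_trans d'd.
rewrite itvE => sd' smax.
have s0 : `|v s| = 0.
  have [//|vs0] := eqVneq `|v s| 0.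
  have [[i k] /= E] := mx_norm_neq0 vs0.
  have {}E : `|v s| = `|v s 0 k| by move: E; rewrite (ord1 i).
  have t0d' : `|t0 - t0| <= d' by rewrite subrr normr0 ltW.
  have [x Hx|c Hc Es] := @mean_value_between (fun x => v x 0 k) (fun x => a x 0 k) t0 s.
    apply/is_derive_mxE/dv; apply: le_trans d'd; exact: between_dist_le Hx _ _.
  have cd' : `|c - t0| <= d' by exact: between_dist_le Hc _ _.
  have cd : `|c - t0| <= d by exact: le_trans d'd.
  have vs1 : `|v s| < 1.
    by apply: Hd1; rewrite -ball_normE /= distrC (le_lt_trans sd').
  have vcs : `|v c| <= `|v s| by apply: smax; rewrite itvE.
  move: Es; rewrite v0 mxE subr0 => Es.
  have ac : `|a c 0 k| <= C' * `|v s|.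
    apply: le_trans (coord_norm_le _ _) _; apply: le_trans (av _ cd) _.
    apply: (@le_trans _ _ (C' * `|v c| ^+ 2)).
      by rewrite ler_wpM2r ?sqr_ge0 // le_max lexx.
    rewrite ler_pM2l // expr2 -[leRHS]mulr1; apply: ler_pM => //.
    exact: ltW (le_lt_trans vcs vs1).
  have := ler_pM (normr_ge0 _) (normr_ge0 _) ac sd'.
  rewrite -normrM -Es -E mulrAC => H.
  have := ler_wpM2r (normr_ge0 (v s)) d'C.
  have : 0 < `|v s| by rewrite lt_neqAle eq_sym vs0 normr_ge0.
  lra.
exists d' => [|t td']; first by rewrite d'0.
apply/eqP; rewrite -normr_eq0; apply/eqP/le_anti; rewrite normr_ge0 andbT -s0.
by apply: smax; rewrite itvE.
Qed.

Lemma continuous_locally_bounded (T : topologicalType) (f : T -> R) x :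
  {for x, continuous f} -> exists2 C : R, 0 < C & \near x, `|f x| <= C.
Proof.
move=> fc; exists (`|f x| + 1); first by rewrite ltr_pwDr.
have nfc : (fun y => `|f y|) @ x --> `|f x| by exact: cvg_norm.
by apply: (cvgr_le _ nfc); rewrite ltrDl.
Qed.

Lemma finite_locally_bounded (T : topologicalType) (I : finType) (f : I -> T -> R) x :
  (forall i, {for x, continuous (f i)}) ->
  exists2 C : R, 0 < C & \near x, forall i, `|f i x| <= C.
Proof.
move=> fc.
have /choice[C HC] i : exists C, 0 < C /\ \near x, `|f i x| <= C.
  by have [C ? ?] := continuous_locally_bounded (fc i); exists C.
exists (1 + \sum_i C i).
  by rewrite ltr_pwDl // sumr_ge0 // => i _; rewrite ltW //; case: (HC i).
near=> y => i; apply: (@le_trans _ _ (C i)).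
  by move: i; near: y; apply: filter_forall => i; case: (HC i).
rewrite (bigD1 i) //= addrCA lerDl addr_ge0 // sumr_ge0 // => j _.
by rewrite ltW //; case: (HC j).
Unshelve. all: by end_near. Qed.

(** Mean value theorem along the segment from [q] to [p], on which the partial
    derivatives are bounded. *)
Lemma Ck1_locally_lipschitz (U : set 'rV[R]_n) (f : 'rV[R]_n -> R) p0 : open U -> U p0 ->
  Ck 1 U f -> exists2 C : R, 0 < C & exists2 r : R, 0 < r & forall p q,
    `|p - p0| <= r -> `|q - p0| <= r -> `|f p - f q| <= C * `|p - q|.
Proof.
move=> oU Up0 [fd fp].
have [C C0 HC] := finite_locally_bounded (fun l => fp l p0 Up0).
have : \near p0, U p0 /\ forall l, `|partial l f p0| <= C.
  by near=> p; split; near: p => //; exact: open_nbhs_nbhs.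
move=> /nbhs_ballP[r /= r0 Hr].
exists (n%:R * C + 1); first by rewrite ltr_wpDl // mulr_ge0 // ltW.
exists (r / 2); first by rewrite divr_gt0.
move=> p q pr qr.
pose g (x : R) := q + x *: (p - q).
have gr x : 0 <= x <= 1 -> ball p0 r (g x).
  move=> /andP[x0 x1]; rewrite -ball_normE /= distrC.
  rewrite (_ : g x - p0 = x *: (p - p0) + (1 - x) *: (q - p0)); last first.
    by apply/rowP => k; rewrite /g !mxE; ring.
  apply: le_lt_trans (ler_normD _ _) _; rewrite !normrZ ger0_norm // ger0_norm ?subr_ge0 //.
  apply: (@le_lt_trans _ _ (r / 2)); last by lra.
  have := ler_wpM2l x0 pr; have := @ler_wpM2l _ (1 - x) _ _ _ qr.
  by rewrite subr_ge0 => /(_ x1); lra.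
have dg (x : R) : is_derive x 1 g (p - q) := is_derive_line q (p - q) x.
have [x Hx|x Hx E] := @mean_value_between (f \o g) (fun x => 'D_(p - q) f (g x)) 0 1.
  rewrite (min_idPl ler01) (max_idPr ler01) in Hx.
  have [Ux _] := Hr _ (gr _ Hx).
  by apply: is_derive_curve; exact: fd.
rewrite (min_idPl ler01) (max_idPr ler01) in Hx.
have [Ux Cx] := Hr _ (gr _ Hx).
move: E; rewrite /= subr0 mulr1 /g scale0r addr0 scale1r addrCA subrr addr0 => ->.
rewrite derive_partial; last exact: fd.
apply: le_trans (ler_norm_sum _ _ _) _.
apply: (@le_trans _ _ (\sum_(l < n) (C * `|p - q|))).
  apply: ler_sum => l _; rewrite normrM mulrC.
  by apply: ler_pM => //; exact: coord_norm_le.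
rewrite sumr_const card_ord -[_ *+ n]mulr_natl mulrA ler_wpM2r //; lra.
Unshelve. all: by end_near. Qed.

End MeanValue.

(** * Penalization, and second derivatives along a curve *)

Section Touching.
Context {R : realType}.

(** Away from [p0] either [D < 0] or [rho > 0], and in the second case [K rho]
    exceeds [D] for [K] large; compactness makes [K] uniform. *)
Lemma penalization (T : topologicalType) (B N : set T) (p0 : T) (D rho : T -> R) :
  compact B -> nbhs p0 N -> (forall p, 0 <= rho p) ->
  (forall p, B p -> {for p, continuous D}) ->
  (forall p, B p -> {for p, continuous rho}) ->
  (forall p, B p -> rho p = 0 -> 0 <= D p -> p = p0) ->
  exists2 K : R, 0 < K & forall p, B p -> K * rho p <= D p -> N p.
Proof.
move=> /compact_near_coveringP cB Np0 rho0 cD crho zero.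
have : \forall K \near +oo, B `<=` [set p | K * rho p <= D p -> N p].
  apply: (cB R +oo (fun K p => K * rho p <= D p -> N p)) => p Bp.
  have [->|pp0] := pselect (p = p0).
    exists (N, setT) => /=; first by split => //; exact: filterT.
    by move=> [q K] [Nq _] _.
  have [rp|rp] := eqVneq (rho p) 0.
    have Dp : D p < 0 by rewrite ltNge; apply/negP => /(zero _ Bp rp).
    exists ([set q | D q < 0], [set K | 0 <= K]) => /=.
      split; first exact: (cvgr_lt _ (cD _ Bp)).
      by apply: nbhs_pinfty_ge; exact: num_real.
    move=> [q K] [/= Dq K0] Kr; exfalso.
    by have := mulr_ge0 K0 (rho0 q); lra.
  have {}rp : 0 < rho p by rewrite lt_neqAle eq_sym rp rho0.
  pose c := `|D p| + 1.
  have c0 : 0 < c by rewrite ltr_wpDl.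
  exists ([set q | D q < c /\ rho p / 2 < rho q], [set K | c / (rho p / 2) <= K]) => /=.
    split; last by apply: nbhs_pinfty_ge; exact: num_real.
    have Dc : D p < c by rewrite /c (le_lt_trans (ler_norm _)) // ltrDl.
    have rc : rho p / 2 < rho p by lra.
    apply: filterI; [exact: (cvgr_lt _ (cD _ Bp))|exact: (cvgr_gt _ (crho _ Bp))].
  move=> [q K] [/= [Dq rq] cK] Kr; exfalso.
  have r2 : 0 < rho p / 2 by lra.
  have K0 : 0 < K by apply: lt_le_trans cK; exact: divr_gt0.
  have : c <= K * rho q.
    rewrite -[c](divfK (lt0r_neq0 r2)).
    by apply: ler_pM => //; apply: ltW => //; exact: divr_gt0.
  lra.
move=> H; have H0 : \forall K \near +oo, (0 : R) < K.
  by apply: nbhs_pinfty_gt; exact: num_real.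
have [K [K0 HK]] := filter_ex (filterI H0 H).
by exists K => // p Bp; exact: HK.
Qed.

Context {n : nat}.

Lemma compact_norm_ball (p : 'rV[R]_n) (r : R) : compact [set q | `|q - p| <= r].
Proof.
apply: bounded_closed_compact.
  exists (r + `|p|); split; first exact: num_real.
  move=> x rx q /= qr; apply: le_trans (ltW rx).
  by rewrite -[q](subrK p) (le_trans (ler_normD _ _)) // lerD.
rewrite (_ : [set q | _] = closed_ball_ Num.Def.normr p r); first exact: closed_closed_ball_.
by apply/funext => q; rewrite /closed_ball_ /= distrC.
Qed.

(** The chain rule for the second derivative of [Phi o g], solved for the term that
    contains the second derivatives of [Phi]. It is stated with a function [E] equal
    to [Phi o g] near [s], so that the second derivative can be computed on [E]. *)
Lemma second_derivative_along (V : set 'rV[R]_n) (Phi : 'rV[R]_n -> R)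
    (g v : R -> 'rV[R]_n) (a : 'rV[R]_n) (s : R) (E E1 : R -> R) (E2 : R) :
  open V -> Ck 2 V Phi -> V (g s) ->
  (\forall t \near s, is_derive t (1 : R) g (v t)) -> is_derive s 1 v a ->
  (\forall t \near s, Phi (g t) = E t) ->
  (\forall t \near s, is_derive t (1 : R) E (E1 t)) -> is_derive s 1 E1 E2 ->
  \sum_k \sum_l v s 0 k * v s 0 l * partial l (partial k Phi) (g s) =
  E2 - \sum_k a 0 k * partial k Phi (g s).
Proof.
move=> oV [Pd Pp] Vgs dg dv PE dE dE1.
have dgs : is_derive s 1 g (v s) := nbhs_singleton dg.
have gc := is_derive_vec_continuous dgs.
have nV : \forall t \near s, V (g t) by apply: gc; exact: open_nbhs_nbhs.
pose G1 := \sum_k ((fun t => v t 0 k) * (partial k Phi \o g)).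
have G1E : \forall t \near s, G1 t = E1 t.
  have PE' := near_join PE; near=> t.
  have dgt : is_derive t (1 : R) g (v t) by near: t.
  have Vgt : V (g t) by near: t.
  have d1 : is_derive t 1 E ('D_(v t) Phi (g t)).
    apply: near_eq_is_derive (is_derive_curve dgt (Pd _ Vgt)).
    by near: t.
  have d2 : is_derive t (1 : R) E (E1 t) by near: t.
  rewrite -(@derive_val _ _ _ _ _ _ _ d2) (@derive_val _ _ _ _ _ _ _ d1).
  rewrite derive_partial; last exact: Pd.
  by rewrite /G1 fct_sumE.
have dG : is_derive s 1 G1 E2.
  apply: near_eq_is_derive dE1; near=> t; apply/esym; near: t; exact: G1E.
have dG' : is_derive s 1 G1 (\sum_k (v s 0 k *: ('D_(v s) (partial k Phi) (g s)) +
    partial k Phi (g s) *: a 0 k)).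
  apply: is_derive_sum => k; apply: is_deriveM.
    exact: is_derive_mxE.
  by apply: is_derive_curve => //; case: (Pp k) => H _; exact: H.
rewrite -(@derive_val _ _ _ _ _ _ _ dG) (@derive_val _ _ _ _ _ _ _ dG').
rewrite big_split /= [X in _ + X - _](eq_bigr (fun k => a 0 k * partial k Phi (g s))); last first.
  by move=> k _; rewrite /GRing.scale /= mulrC.
rewrite addrK.
apply: eq_bigr => k _; rewrite derive_partial; last by case: (Pp k) => H _; exact: H.
by rewrite /GRing.scale /= mulr_sumr; apply: eq_bigr => l _; rewrite mulrA.
Unshelve. all: by end_near. Qed.

End Touching.

(** * The time coordinate of a curve and the Christoffel defect *)

Section GeodesicTouching.
Context {R : realType} {n : nat}.

Lemma finite_locally_lipschitz (I : finType) (U : set 'rV[R]_n) (f : I -> 'rV[R]_n -> R) p0 :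
  open U -> U p0 -> (forall i, Ck 1 U (f i)) -> exists2 C : R, 0 < C &
    \forall x \near (p0, p0), forall i, `|f i x.1 - f i x.2| <= C * `|x.1 - x.2|.
Proof.
move=> oU Up0 Hf.
have /choice[C HC] i : exists C, 0 < C /\
    \forall x \near (p0, p0), `|f i x.1 - f i x.2| <= C * `|x.1 - x.2|.
  have [C C0 [r r0 H]] := Ck1_locally_lipschitz oU Up0 (Hf i).
  exists C; split=> //; exists (ball p0 r, ball p0 r) => /=.
    by split; exact: nbhsx_ballx.
  move=> [p q] [/= pr qr]; apply: H.
    by move: pr; rewrite -ball_normE /= distrC => /ltW.
  by move: qr; rewrite -ball_normE /= distrC => /ltW.
exists (1 + \sum_i C i).
  by rewrite ltr_pwDl // sumr_ge0 // => i _; rewrite ltW //; case: (HC i).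
near=> x => i; apply: (@le_trans _ _ (C i * `|x.1 - x.2|)).
  by move: i; near: x; apply: filter_forall => i; case: (HC i).
rewrite ler_wpM2r // (bigD1 i) //= addrCA lerDl addr_ge0 // sumr_ge0 // => j _.
by rewrite ltW //; case: (HC j).
Unshelve. all: by end_near. Qed.

Lemma ler_norm_sum_const (F : 'I_n -> R) (M : R) :
  (forall i, `|F i| <= M) -> `|\sum_i F i| <= n%:R * M.
Proof.
move=> FM; apply: le_trans (ler_norm_sum _ _ _) _.
rewrite mulr_natl -[X in _ *+ X]card_ord -sumr_const.
by apply: ler_sum => i _; exact: FM.
Qed.

(** When [G] are Christoffel symbols, a curve is a geodesic if and only if its
    acceleration is the opposite of this field, taken at its position and velocity. *)
Definition quadratic_field (G : 'I_n -> 'I_n -> 'I_n -> 'rV[R]_n -> R)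
    (p w : 'rV[R]_n) : 'rV[R]_n :=
  \row_k \sum_a \sum_b G k a b p * w 0 a * w 0 b.

(** Here [dG] is the variation of the Christoffel symbols between [p] and the point
    of the curve with the same time coordinate, [z] is the difference of these points,
    [dA + K (2 z . dY)] is the differential of the penalized test function, and [w] is
    the velocity. What matters is that the large factor [K] comes with [|z|^2], which
    the penalization controls. *)
Lemma christoffel_defect_bound (C K : R) (dG : 'I_n -> 'I_n -> 'I_n -> R)
    (w z : 'rV[R]_n) (dA : 'I_n -> R) (dY : 'I_n -> 'I_n -> R) :
  0 <= C -> 0 <= K ->
  (forall k a b, `|dG k a b| <= C * `|z|) -> (forall a, `|w 0 a| <= C) ->
  (forall k, `|dA k| <= C) -> (forall k m, `|dY k m| <= C) ->
  `|\sum_k (\sum_a \sum_b dG k a b * w 0 a * w 0 b) *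
     (dA k + K * \sum_m (2 * z 0 m * dY k m))| <=
  n%:R ^+ 3 * C ^+ 4 * `|z| + 2 * n%:R ^+ 4 * C ^+ 4 * (K * `|z| ^+ 2).
Proof.
move=> C0 K0 HG Hw HA HY.
have -> : n%:R ^+ 3 * C ^+ 4 * `|z| + 2 * n%:R ^+ 4 * C ^+ 4 * (K * `|z| ^+ 2) =
    n%:R * ((n%:R * (n%:R * (C * `|z| * C * C))) *
      (C + K * (n%:R * (2 * `|z| * C)))) by ring.
apply: ler_norm_sum_const => k; rewrite normrM; apply: ler_pM => //.
  apply: ler_norm_sum_const => a; apply: ler_norm_sum_const => b.
  by rewrite !normrM; do 2?apply: ler_pM => //.
apply: le_trans (ler_normD _ _) _; apply: lerD => //.
rewrite normrM ger0_norm // ler_wpM2l //; apply: ler_norm_sum_const => m.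
rewrite !normrM; do 2?apply: ler_pM => //; last exact: coord_norm_le.
by rewrite ger0_norm.
Qed.

Lemma Ck_dot k (U : set 'rV[R]_n) (w : 'rV[R]_n) : open U ->
  Ck k U (fun p => \sum_a w 0 a * p 0 a).
Proof.
move=> oU; apply: Ck_sum => // a _.
by apply: (CkM oU); [exact: Ck_cst|exact: Ck_coord].
Qed.

(** Near [t0] the function [<v t0, u t>] of [t] is increasing; [th p] is the time at
    which it equals [<v t0, p>]. The hyperplanes orthogonal to [v t0] are its level
    sets, so adding to [p] an increment of [u] shifts [th] as it shifts time. *)
Lemma time_coordinate (u v a : R -> 'rV[R]_n) (t0 d : R) : 0 < d ->
  (forall t, `|t - t0| < d -> is_derive t 1 u (v t)) ->
  (forall t, `|t - t0| < d -> is_derive t 1 v (a t)) ->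
  (forall t, `|t - t0| < d -> {for t, continuous a}) ->
  v t0 != 0 ->
  exists (V : set 'rV[R]_n) (th : 'rV[R]_n -> R), [/\ open V, V (u t0), th (u t0) = t0,
    Ck 2 V th & forall p, V p -> `|th p - t0| < d /\
      \forall t \near th p, th (p + (u t - u (th p))) = t].
Proof.
move=> d0 du dv ca v0.
pose w := v t0.
pose l (p : 'rV[R]_n) := \sum_k w 0 k * p 0 k.
have lD p q : l (p + q) = l p + l q.
  by rewrite /l -big_split; apply: eq_bigr => k _; rewrite mxE mulrDr.
have lN p : l (- p) = - l p.
  by rewrite /l -sumrN; apply: eq_bigr => k _; rewrite mxE mulrN.
have Hl : Ck 2 setT l by exact/Ck_dot/openT.
have dl p : differentiable l p by case: Hl => H _; exact: H.
have cl : continuous l by move=> p; exact: differentiable_continuous.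
have lder p q : 'D_q l p = l q.
  have := is_derive_curve (is_derive_line p q 0) (f := l).
  rewrite scale0r addr0 => /(_ (dl _)) H.
  rewrite -(@derive_val _ _ _ _ _ _ _ H).
  have {}H : is_derive (0 : R) 1 (l \o (fun t => p + t *: q)) (l q).
    rewrite (_ : _ \o _ = fun t : R => l p + t *: l q); first exact: is_derive_line.
    apply/funext => t /=; rewrite lD; congr (_ + _).
    by rewrite /l /GRing.scale /= mulr_sumr; apply: eq_bigr => k _; rewrite !mxE; ring.
  by rewrite (@derive_val _ _ _ _ _ _ _ H).
have ds t : `|t - t0| < d -> is_derive t 1 (l \o u) ((l \o v) t).
  by move=> /du dut; have := is_derive_curve dut (dl _); rewrite lder.
have ds1 t : `|t - t0| < d -> is_derive t 1 (l \o v) ((l \o a) t).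
  by move=> /dv dvt; have := is_derive_curve dvt (dl _); rewrite lder.
have lw : 0 < (l \o v) t0.
  by rewrite /= -/w; have := sqn_gt0 v0; congr (0 < _); apply: eq_bigr => k _; rewrite expr2.
have t0d : `|t0 - t0| < d by rewrite subrr normr0.
have : \forall t \near t0, `|t - t0| < d /\ 0 < (l \o v) t.
  near=> t; split; near: t.
    by exists d => // t /=; rewrite distrC.
  by apply: (cvgr_gt _ (is_derive1_continuous (ds1 _ t0d))).
move=> /nbhs_ballP[d1 /= d10 Hd1].
have itv t : t0 - d1 < t < t0 + d1 -> `|t - t0| < d /\ 0 < (l \o v) t.
  by move=> Ht; apply: Hd1; rewrite -ball_normE /= distrC ltr_distl.
have [|t /itv[]|t /itv[]|t /itv[] td _|t /itv[]//|O [tau [oO Ot0 tauP tauK Htau]]] :=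
  @inverse_derivative_tower R (t0 - d1) (t0 + d1) t0 (l \o u) (l \o v) (l \o a).
- by rewrite ltrBlDr !ltrDl d10.
- by move=> /ds.
- by move=> /ds1.
- by apply: continuous_comp; [exact: ca|exact: cl].
exists (l @^-1` O), (tau \o l).
have oV : open (l @^-1` O) by apply: open_comp => // p _; exact: cl.
split=> //.
- by rewrite /=; apply: tauK => //; rewrite ltrBlDr !ltrDl d10.
- by apply: (@Ck_comp1 R n 2 (l @^-1` O) O l tau) => //; exact: Ck_sub Hl.
move=> p /= Op; have [Ht E] := tauP _ Op; have [td _] := itv _ Ht; split=> //.
have ct := is_derive1_continuous (ds _ td).
near=> t; rewrite !lD lN -[l (u (tau _))]/((l \o u) (tau (l p))) E addrCA subrr addr0.
apply: tauK.
  apply/andP; split; near: t; move: Ht => /andP[]; [move=> H _|move=> _ H].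
    exact: lt_nbhsr.
  exact: lt_nbhsl.
by near: t; apply: ct; rewrite E; exact: open_nbhs_nbhs.
Unshelve. all: by end_near. Qed.

End GeodesicTouching.

(** * A strict touching from above along a geodesic, in coordinates *)

Section LocalTouching.
Context {R : realType} {n : nat}.

Lemma quadratic_field_continuous (G : 'I_n -> 'I_n -> 'I_n -> 'rV[R]_n -> R)
    (u v : R -> 'rV[R]_n) (t : R) :
  (forall k a b, {for u t, continuous (G k a b)}) ->
  {for t, continuous u} -> {for t, continuous v} ->
  {for t, continuous (fun s => - quadratic_field G (u s) (v s))}.
Proof.
move=> cG cu cv.
have cva a : {for t, continuous (fun s => v s 0 a)}.
  apply: (@continuous_comp _ _ _ v (fun x : 'rV[R]_n => x 0 a : R)) => //.
  exact: coord_continuous.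
suff H : {for t, continuous (fun s => quadratic_field G (u s) (v s))} by exact: cvgN H.
apply: row_continuous => k.
rewrite (_ : (fun s => _) = fun s => \sum_a \sum_b G k a b (u s) * v s 0 a * v s 0 b).
  2: by apply/funext => s; rewrite mxE.
apply: sum_continuous => a; apply: sum_continuous => c.
apply: (cvgM _ (cva c)); apply: (cvgM _ (cva a)).
by apply: continuous_comp; [exact: cu|exact: cG].
Qed.

(** The penalty [K rho] forces the maximum close to the curve, but not onto it. At
    the maximum point the Hessian is therefore computed along a translate of the
    curve, on which [rho] is constant; the translate is a geodesic only up to the
    defect bounded by [christoffel_defect_bound], and this defect is smaller than
    the concavity of the parabola. *)
Lemma touching_geodesic (W : set 'rV[R]_n)
    (G : 'I_n -> 'I_n -> 'I_n -> 'rV[R]_n -> R) (u v : R -> 'rV[R]_n)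
    (F : 'rV[R]_n -> R) (t0 d b e r : R) :
  open W -> (forall k a b, Ck 1 W (G k a b)) -> 0 < d ->
  (forall t, `|t - t0| < d -> [/\ W (u t), is_derive t 1 u (v t) &
     is_derive t 1 v (- quadratic_field G (u t) (v t))]) ->
  v t0 != 0 -> (forall p, W p -> {for p, continuous F}) -> 0 < e ->
  (forall t, `|t - t0| < d ->
     F (u t) - F (u t0) <= b * (t - t0) - e * (t - t0) ^+ 2) ->
  0 < r ->
  exists (V : set 'rV[R]_n) (Phi : 'rV[R]_n -> R) (p w : 'rV[R]_n),
    [/\ open V, V p /\ W p /\ `|p - u t0| < r, Ck 2 V Phi,
        \forall q \near p, F q - Phi q <= F p - Phi p &
        \sum_k \sum_l w 0 k * w 0 l * partial l (partial k Phi) p -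
        \sum_k quadratic_field G p w 0 k * partial k Phi p < 0].
Proof.
move=> oW HG d0 geo v0 cF e0 touch r0.
have t0d : `|t0 - t0| < d by rewrite subrr normr0.
set p0 := u t0; have Wp0 : W p0 by case: (geo _ t0d).
have du t : `|t - t0| < d -> is_derive t 1 u (v t) by move=> /geo[].
have dv t : `|t - t0| < d -> is_derive t 1 v (- quadratic_field G (u t) (v t)).
  by move=> /geo[].
have cu t : `|t - t0| < d -> {for t, continuous u} by move=> /du /is_derive_vec_continuous.
have cv t : `|t - t0| < d -> {for t, continuous v} by move=> /dv /is_derive_vec_continuous.
have ca t : `|t - t0| < d -> {for t, continuous (fun s => - quadratic_field G (u s) (v s))}.
  move=> td; apply: quadratic_field_continuous; [|exact: cu|exact: cv].
  by move=> k a c; apply: Ck_continuous (HG k a c) _; case: (geo _ td).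
have [V0 [th [oV0 V0p0 thp0 Hth thP]]] := time_coordinate d0 du dv ca v0.
pose V := V0 `&` W.
have oV : open V by exact: openI.
have {}Hth : Ck 2 V th by apply: Ck_sub Hth; exact: subIsetl.
have Vp0 : V p0 by [].
have {}thP p : V p -> `|th p - t0| < d /\ \forall t \near th p, th (p + (u t - u (th p))) = t.
  by case=> /thP.
have cth p : V p -> {for p, continuous th} by move=> Vp; exact: Ck_continuous Hth Vp.
pose y k (p : 'rV[R]_n) : R := p 0 k - u (th p) 0 k.
have yE p : \row_k y k p = p - u (th p) by apply/rowP => k; rewrite !mxE.
have Hy k : Ck 2 V (y k).
  apply: (CkB oV); first exact: Ck_coord.
  apply: (@Ck_comp1 R n 2 V [set t | `|t - t0| < d] th (fun t => u t 0 k)) => //.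
    by move=> p /thP[].
  exists (fun t => v t 0 k); first by move=> t /du; exact: is_derive_mxE.
  exists (fun t => (- quadratic_field G (u t) (v t)) 0 k).
    by move=> t /dv; exact: is_derive_mxE.
  move=> t /ca ct; apply: (@continuous_comp _ _ _ _ (fun x : 'rV[R]_n => x 0 k : R)) => //.
  exact: coord_continuous.
pose rho p := \sum_k y k p ^+ 2.
have rhoE p : rho p = sqn (p - u (th p)) by apply: eq_bigr => k _; rewrite -yE mxE.
have Hrho : Ck 2 V rho by exact: Ck_sqn.
(* Half of the concavity is kept in [q]; the other half makes the touching strict,
   which singles out [p0] among the points of the curve. *)
pose q t := b * (t - t0) - e / 2 * ((t - t0) * (t - t0)).
pose A p := q (th p).
have HA : Ck 2 V A.
  have Ht : Ck 2 V (th - cst t0) := CkB oV Hth (Ck_cst 2 V t0).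
  exact: (CkB oV (CkM oV (Ck_cst 2 V b) Ht) (CkM oV (Ck_cst 2 V (e / 2)) (CkM oV Ht Ht))).
pose D p := F p - F p0 - A p.
have cA p : V p -> {for p, continuous A} by move=> Vp; exact: Ck_continuous HA Vp.
have crho p : V p -> {for p, continuous rho} by move=> Vp; exact: Ck_continuous Hrho Vp.
have cD p : V p -> {for p, continuous D}.
  move=> Vp; have cFp : F @ p --> F p by apply: cF; case: Vp.
  exact: (cvgB (cvgB cFp (cvg_cst (F p0))) (cA _ Vp)).
have D0 : D p0 = 0 by rewrite /D /A thp0 /q !subrr; ring.
have cz p : V p -> {for p, continuous (fun p : 'rV[R]_n => p - u (th p))}.
  move=> Vp; have [td _] := thP _ Vp.
  exact: (cvgB cvg_id (continuous_comp (cth _ Vp) (cu _ td))).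
have z0 : p0 - u (th p0) = 0 by rewrite thp0 subrr.
(* Bounds near [p0] for all the quantities that enter [christoffel_defect_bound], none
   of which depends on [K]. *)
have [C1 C10 B1] := finite_locally_bounded (fun k => Ck_continuous (Ck_partial k HA) Vp0).
have [C2 C20 B2] := finite_locally_bounded
  (fun km : 'I_n * 'I_n => Ck_continuous (Ck_partial km.1 (Hy km.2)) Vp0).
have [td0 _] := thP _ Vp0.
have cvth k : {for p0, continuous (fun p : 'rV[R]_n => v (th p) 0 k)}.
  apply: (@continuous_comp _ _ _ (v \o th) (fun x : 'rV[R]_n => x 0 k : R)).
    exact: (continuous_comp (cth _ Vp0) (cv _ td0)).
  exact: coord_continuous.
have [C3 C30 B3] := finite_locally_bounded cvth.
have [C4 C40 B4] := finite_locally_lipschitz oW Wp0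
  (fun kab : 'I_n * 'I_n * 'I_n => HG kab.1.1 kab.1.2 kab.2).
have {}B4 : \near p0, forall k a c,
    `|G k a c (u (th p0)) - G k a c p0| <= C4 * `|p0 - u (th p0)|.
  have cpair : (fun p => (u (th p), p)) @ p0 --> (p0, p0).
    have cuth : (fun p => u (th p)) @ p0 --> p0.
      have E : u (th p0) = p0 by rewrite thp0.
      rewrite -[X in _ --> X]E; exact: (continuous_comp (cth _ Vp0) (cu _ td0)).
    exact: (cvg_pair cuth cvg_id).
  near=> p => k a c.
  have Hp : forall i : 'I_n * 'I_n * 'I_n,
    `|G i.1.1 i.1.2 i.2 (u (th p)) - G i.1.1 i.1.2 i.2 p| <= C4 * `|u (th p) - p|.
    by near: p; exact: (cpair _ B4).
  by rewrite [`|p - _|]distrC; exact: (Hp (k, a, c)).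
pose C : R := C1 + C2 + C3 + C4.
pose M : R := n%:R ^+ 3 * C ^+ 4 + 2 * n%:R ^+ 4 * C ^+ 4.
have C0 : 0 <= C by rewrite /C; clear - C10 C20 C30 C40; lra.
have [C1C C2C C3C C4C] : [/\ C1 <= C, C2 <= C, C3 <= C & C4 <= C].
  by rewrite /C; clear - C10 C20 C30 C40; split; lra.
have M0 : 0 <= M by rewrite /M addr_ge0 // ?mulr_ge0 // ?exprn_ge0.
(* The defect is at most [M * eta < e] once [|z|] and [K * |z|^2] are below [eta]. *)
pose eta : R := e / (2 * (M + 1)).
have M1 : 0 < 2 * (M + 1) by clear - M0; lra.
have eE : 2 * (M * eta + eta) = e.
  by rewrite /eta; field; move: M1; clear; rewrite pmulr_rgt0 // => /gt_eqF ->.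
have eta0 : 0 < eta by rewrite divr_gt0.
have [rB rB0 BV] : exists2 rB : R, 0 < rB & [set p : 'rV[R]_n | `|p - p0| <= rB] `<=` V.
  have /nbhs_ballP[r1 /= r10 Hr1] : nbhs p0 V by exact: open_nbhs_nbhs.
  exists (r1 / 2); first by rewrite divr_gt0.
  by move=> p /= pr; apply: Hr1; rewrite -ball_normE /= distrC; lra.
pose B := [set p : 'rV[R]_n | `|p - p0| <= rB].
pose N := [set p : 'rV[R]_n | [/\ `|p - p0| < r, `|p - p0| < rB, `|p - u (th p)| < eta, D p < eta &
  [/\ forall k, `|partial k A p| <= C, forall k m, `|partial k (y m) p| <= C,
      forall k, `|v (th p) 0 k| <= C &
      forall k a c, `|G k a c (u (th p)) - G k a c p| <= C * `|p - u (th p)|]]].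
have nB (x : R) : 0 < x -> \forall p \near p0, `|p - p0| < x.
  by move=> x0; apply/nbhs_ballP; exists x => // p; rewrite -ball_normE /= distrC.
have Np0 : nbhs p0 N.
  rewrite -[nbhs _ _]/(\forall p \near p0, N p) /N; near=> p; split.
  - by near: p; exact: nB.
  - by near: p; exact: nB.
  - near: p; have H : (fun p => `|p - u (th p)|) @ p0 --> `|p0 - u (th p0)|.
      exact: (cvg_norm (cz _ Vp0)).
    by apply: (cvgr_lt _ H); rewrite z0 normr0.
  - by near: p; apply: (cvgr_lt _ (cD _ Vp0)); rewrite D0.
  - split=> [k|k m|k|k a c].
    + apply: le_trans C1C.
      by move: k; near: p; exact: B1.
    + apply: le_trans C2C.
      have H : forall i : 'I_n * 'I_n, `|partial i.1 (y i.2) p| <= C2 by near: p; exact: B2.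
      exact: (H (k, m)).
    + apply: le_trans C3C.
      by move: k; near: p; exact: B3.
    + apply: (@le_trans _ _ (C4 * `|p - u (th p)|)); last first.
        by rewrite ler_wpM2r.
      by move: k a c; near: p; exact: B4.
have [K K0 pen] : exists2 K : R, 0 < K & forall p, B p -> K * rho p <= D p -> N p.
  apply: (penalization (p0 := p0)) => //.
  - exact: compact_norm_ball.
  - by move=> p; rewrite rhoE sqn_ge0.
  - by move=> p /BV; exact: cD.
  - by move=> p /BV; exact: crho.
  - move=> p /BV Vp; rewrite rhoE => /sqn_eq0 /eqP; rewrite subr_eq0 => /eqP pE Dp.
    have [td _] := thP _ Vp; have := touch _ td; rewrite -pE -/p0.
    move: Dp; rewrite /D /A /q; set s := th p - t0 => Dp tch.
    have s0 : s = 0.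
      apply/eqP; rewrite -sqrf_eq0; apply/eqP/le_anti; rewrite sqr_ge0 andbT.
      rewrite -(pmulr_rle0 _ e0); move: tch Dp; rewrite expr2; lra.
    by rewrite pE /p0; congr u; apply/eqP; rewrite -subr_eq0 -/s s0.
pose Phi p := A p + K * rho p.
have HPhi : Ck 2 V Phi.
  exact: (CkD oV HA (CkM oV (Ck_cst 2 V K) Hrho)).
have [||p] := @compact_EVT_max _ R (fun p => D p - K * rho p) B _ (@compact_norm_ball R n p0 rB).
- by exists p0; rewrite /B /= subrr normr0 ltW.
- apply: continuous_in_subspaceT => p; rewrite inE => /BV Vp.
  exact: (cvgB (cD _ Vp) (cvgM (cvg_cst K) (crho _ Vp))).
rewrite inE => Bp pmax; have Vp := BV _ Bp.
have KD : K * rho p <= D p.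
  rewrite -subr_ge0; apply: le_trans (pmax p0 _).
    by rewrite D0 rhoE z0 sqn0 mulr0 subr0.
  by rewrite inE /B /= subrr normr0 ltW.
have [pr prB zeta Deta [bA bY bv bG]] := pen _ Bp KD.
exists V, Phi, p, (v (th p)); split=> //.
- by split=> //; split=> //; case: Vp.
- near=> x; have Bx : B x.
    rewrite /B /=; apply: ltW; near: x.
    have H : (fun x => `|x - p0|) @ p --> `|p - p0|.
      exact: (cvg_norm (cvgB cvg_id (cvg_cst _))).
    exact: (cvgr_lt _ H).
  by have := pmax x; rewrite inE => /(_ Bx); rewrite /D /Phi; clear; lra.
have [td thnear] := thP _ Vp.
set s := th p in zeta bv bG thnear td *; set z := p - u s in zeta bG.
(* Along [g] the vector [z] does not change and [th] is the parameter. *)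
pose g t := p + (u t - u s).
have gs : g s = p by rewrite /g subrr addr0.
have nd : \forall t \near s, `|t - t0| < d.
  have H : (fun t => `|t - t0|) @ s --> `|s - t0|.
    exact: (cvg_norm (cvgB cvg_id (cvg_cst _))).
  exact: (cvgr_lt _ H).
have key := @second_derivative_along R n V Phi g v (- quadratic_field G (u s) (v s)) s
  (fun t => q t + K * sqn z) (fun t => b - e * (t - t0)) (- e) oV HPhi.
rewrite gs in key.
have {}key := key Vp.
have ndg : \forall t \near s, is_derive t (1 : R) g (v t).
  near=> t; have -> : v t = 0 + (v t - 0) by rewrite add0r subr0.
  have dut : is_derive t 1 u (v t) by apply: du; near: t; exact: nd.
  exact: (is_deriveD (is_derive_cst p t (1 : R)) (is_deriveB dut (is_derive_cst (u s) t (1 : R)))).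
have nPhi : \forall t \near s, Phi (g t) = q t + K * sqn z.
  near=> t; have tht : th (g t) = t by near: t.
  rewrite /Phi /A rhoE tht.
  by congr (_ + _ * sqn _); rewrite /g /z; apply/rowP => k; rewrite !mxE; ring.
have ndE : \forall t \near s,
    is_derive t (1 : R) (fun t => q t + K * sqn z) (b - e * (t - t0)).
  near=> t.
  pose h (x : R) := - t0 + x *: (1 : R).
  have dh : is_derive t 1 h 1 by exact: is_derive_line.
  have := is_deriveD (is_deriveB (is_deriveM (is_derive_cst b t (1 : R)) dh)
    (is_deriveM (is_derive_cst (e / 2) t (1 : R)) (is_deriveM dh dh)))
    (is_derive_cst (K * sqn z) t (1 : R)).
  rewrite (_ : _ + cst _ = fun t => q t + K * sqn z); last first.
    by apply/funext => x; rewrite !fctE /q /h /GRing.scale /=; ring.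
  by move=> H; apply: is_derive_eq H _; rewrite /h /GRing.scale /=; field.
have dE1 : is_derive s 1 (fun t => b - e * (t - t0)) (- e).
  rewrite (_ : (fun t : R => _) = fun t : R => (b + e * t0) + t *: (- e)).
    exact: is_derive_line.
  by apply/funext => t; rewrite /GRing.scale /=; ring.
rewrite (key ndg (dv _ td) nPhi ndE dE1).
(* The gradient of [rho] is of order [|z|], since [rho] is a sum of squares. *)
have dPhi k : partial k Phi p = partial k A p + K * \sum_m (2 * z 0 m * partial k (y m) p).
  have dA : is_derive p (delta_mx 0 k) A (partial k A p).
    exact/derivableP/diff_derivable/(Ck_differentiable HA).
  have dy m : is_derive p (delta_mx 0 k) (y m) (partial k (y m) p).
    exact/derivableP/diff_derivable/(Ck_differentiable (Hy m)).
  have drho := is_derive_sum (fun m => is_deriveM (dy m) (dy m)).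
  have dP := is_deriveD dA (is_deriveM (is_derive_cst K p (delta_mx 0 k : 'rV[R]_n)) drho).
  have rE : rho = \sum_m (y m * y m).
    by apply/funext => x; rewrite fct_sumE; apply: eq_bigr => m _; rewrite expr2.
  have PE : Phi = A + cst K * rho by [].
  rewrite {1}/partial PE rE.
  rewrite (@derive_val _ _ _ _ _ _ _ dP) scaler0 addr0.
  rewrite /GRing.scale /=; congr (_ + _ * _).
  apply: eq_bigr => m _.
  by have -> : z 0 m = y m p; [rewrite /z /s -yE mxE|ring].
have := @christoffel_defect_bound R n C K (fun k a c => G k a c (u s) - G k a c p) (v s) z
  (fun k => partial k A p) (fun k m => partial k (y m) p) C0 (ltW K0) bG bv bA bY.
set S := \sum_k _ => HS.
have {}HS : `|S| <= M * eta.
  apply: le_trans HS _; rewrite /M [leRHS]mulrDl; apply: lerD.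
    by rewrite ler_wpM2l ?mulr_ge0 ?exprn_ge0 // ltW.
  rewrite ler_wpM2l ?mulr_ge0 ?exprn_ge0 //.
  apply: le_trans (ltW Deta); apply: le_trans KD.
  by rewrite ler_wpM2l ?(ltW K0) // rhoE norm_le_sqn.
have -> : - e - \sum_k (- quadratic_field G (u s) (v s)) 0 k * partial k Phi p -
    \sum_k quadratic_field G p (v s) 0 k * partial k Phi p = - e + S.
  rewrite -!addrA; congr (_ + _); rewrite -!sumrN -big_split; apply: eq_bigr => k _ /=.
  rewrite !mxE dPhi !mulNr opprK -mulrBl; congr (_ * _).
  rewrite -sumrB; apply: eq_bigr => a _; rewrite -sumrB; apply: eq_bigr => c _; ring.
have : S <= M * eta by apply: le_trans HS; exact: ler_norm.
have := mulr_ge0 M0 (ltW eta0); clear - eE eta0; lra.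
Unshelve. all: by end_near. Qed.

End LocalTouching.

(** * The Riemannian Hessian in coordinates *)

Section HessianFormula.
Context {R : realType} {n : nat}.

Lemma Ck_det k m (U : set 'rV[R]_n) (A : 'rV[R]_n -> 'M[R]_m) : open U ->
  (forall a b, Ck k U (fun p => A p a b)) -> Ck k U (fun p => \det (A p)).
Proof.
move=> oU HA; apply: Ck_sum => // s _.
apply: (CkM oU); first exact: Ck_cst.
by apply: Ck_prod.
Qed.

Lemma Ck_invmx k m (U : set 'rV[R]_n) (A : 'rV[R]_n -> 'M[R]_m) a b : open U ->
  (forall p, U p -> A p \in unitmx) ->
  (forall a b, Ck k U (fun p => A p a b)) -> Ck k U (fun p => invmx (A p) a b).
Proof.
move=> oU uA HA.
apply: (@Ck_eq _ _ _ _ _ (fun p => (\det (A p))^-1 * \adj (A p) a b)) => //.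
  by move=> p Up; rewrite /invmx uA // [RHS]mxE.
apply: (CkM oU).
  apply: CkV => //; last exact: Ck_det.
  by move=> p Up; have := uA p Up; rewrite unitmxE unitfE.
apply: (@Ck_eq _ _ _ _ _ (fun p => (-1) ^+ (b + a) * \det (row' b (col' a (A p))))) => //.
  by move=> p Up; rewrite mxE.
apply: (CkM oU); first exact: Ck_cst.
apply: Ck_det => // c d; apply: Ck_eq (HA (lift b c) (lift a d)) => // p Up.
by rewrite !mxE.
Qed.

Lemma bilinE (A : 'M[R]_n) (x y : 'rV[R]_n) :
  bilin A x y = \sum_a \sum_b x 0 a * A a b * y 0 b.
Proof.
rewrite /bilin mxE exchange_big /=; apply: eq_bigr => b _.
by rewrite mxE mulr_suml; apply: eq_bigr => a _; rewrite !mxE.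
Qed.

(** The index computations behind the coordinate expression of the Hessian, at a
    fixed point: [P a b c] stands for the derivative of [g b c] in the direction
    [a]. Lowering the upper index of the Christoffel symbols with [g] removes the
    inverse matrix from their definition. *)
Section Lowering.
Variables (g ginv : 'M[R]_n) (P : 'I_n -> 'I_n -> 'I_n -> R).
Hypotheses (gsym : g^T = g) (gK : g *m ginv = 1%:M) (Psym : forall a b c, P a b c = P a c b).

Let gamma k a b := 2^-1 * \sum_l ginv k l * (P a b l + P b a l - P l a b).
Let T3 (x y w : 'rV[R]_n) := \sum_a \sum_b \sum_c P a b c * x 0 a * y 0 b * w 0 c.

Let T3_sym (x y w : 'rV[R]_n) : T3 x y w = T3 x w y.
Proof.
apply: eq_bigr => a _; rewrite exchange_big /=; apply: eq_bigr => b _.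
by apply: eq_bigr => c _; rewrite Psym; ring.
Qed.

Let lower_gamma a b m : \sum_k gamma k a b * g k m = 2^-1 * (P a b m + P b a m - P m a b).
Proof.
rewrite /gamma; under eq_bigr do rewrite -mulrA mulr_suml.
rewrite -mulr_sumr exchange_big /=; congr (_ * _).
rewrite (bigD1 m) //= [X in _ + X]big1 ?addr0 => [|l lm].
  have E : \sum_k g m k * ginv k m = 1.
    by have := congr1 (fun A : 'M[R]_n => A m m) gK; rewrite !mxE eqxx.
  rewrite -[RHS]mul1r -E mulr_suml; apply: eq_bigr => k _.
  by rewrite -[in LHS]gsym mxE; ring.
have E : \sum_k g m k * ginv k l = 0.
  by have := congr1 (fun A : 'M[R]_n => A m l) gK; rewrite !mxE eq_sym (negPf lm).
transitivity (\sum_k g m k * ginv k l * (P a b l + P b a l - P l a b)).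
  by apply: eq_bigr => k _; rewrite -[in LHS]gsym mxE; ring.
by rewrite -mulr_suml E mul0r.
Qed.

Let lower_quadratic (x y w : 'rV[R]_n) :
  \sum_k (\sum_a \sum_b gamma k a b * x 0 a * y 0 b) * (\sum_m g k m * w 0 m) =
  2^-1 * (T3 x y w + T3 y x w - T3 w x y).
Proof.
transitivity (\sum_a \sum_b \sum_m (\sum_k gamma k a b * g k m) * (x 0 a * y 0 b * w 0 m)).
  under eq_bigr do rewrite mulr_suml.
  rewrite exchange_big /=; apply: eq_bigr => a _.
  under eq_bigr do rewrite mulr_suml.
  rewrite exchange_big /=; apply: eq_bigr => b _.
  under eq_bigr do rewrite mulr_sumr.
  rewrite exchange_big /=; apply: eq_bigr => m _.
  by rewrite mulr_suml; apply: eq_bigr => k _; ring.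
have -> : T3 y x w = \sum_a \sum_b \sum_m P b a m * x 0 a * y 0 b * w 0 m.
  rewrite /T3 exchange_big /=; apply: eq_bigr => a _; apply: eq_bigr => b _.
  by apply: eq_bigr => m _; ring.
have -> : T3 w x y = \sum_a \sum_b \sum_m P m a b * x 0 a * y 0 b * w 0 m.
  rewrite /T3 exchange_big /=; apply: eq_bigr => a _.
  rewrite exchange_big /=; apply: eq_bigr => b _.
  by apply: eq_bigr => m _; ring.
rewrite /T3 -big_split -sumrB mulr_sumr; apply: eq_bigr => a _.
rewrite -big_split -sumrB mulr_sumr; apply: eq_bigr => b _.
rewrite -big_split -sumrB mulr_sumr; apply: eq_bigr => m _.
by rewrite lower_gamma /=; ring.
Qed.

(** Compatibility of the connection with the metric, written in coordinates:
    [g(Gamma(v, h), v) + g(Gamma(v, v), h)] is the derivative of [g(v, h)] along [v]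
    for constant [v] and [h]. *)
Lemma christoffel_exchange (v h : 'rV[R]_n) :
  \sum_k (\sum_a \sum_b gamma k a b * v 0 a * h 0 b) * (\sum_m g k m * v 0 m) =
  \sum_a \sum_b \sum_c P a b c * v 0 a * v 0 b * h 0 c -
  \sum_k (\sum_a \sum_b gamma k a b * v 0 a * v 0 b) * (\sum_m g k m * h 0 m).
Proof. by rewrite !lower_quadratic -/(T3 v v h) (T3_sym v h v); lra. Qed.

End Lowering.

Context {M : riemannianManifold R n}.
Implicit Types (i : cindex M).

Let cimg i := cmap i @` cdom i.

Lemma gmx_unit i p : cimg i p -> gmx i p \in unitmx.
Proof.
move=> [x dx <-]; rewrite -row_free_unit; apply: inj_row_free => v vg.
apply/eqP/negP => /negP v0; have := gmx_pos dx v0.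
by rewrite /bilin vg mul0mx mxE ltxx.
Qed.

Lemma gmx_symE i p : cimg i p -> (gmx i p)^T = gmx i p.
Proof. by move=> [x dx <-]; exact: gmx_sym. Qed.

Lemma Ck_gmx k i a b : Ck k (cimg i) (fun p => gmx i p a b).
Proof. by apply: Ck_mx; [exact: cimg_open|exact: gmx_smooth]. Qed.

Lemma Ck_christoffel m i k a b : Ck m (cimg i) (fun p => christoffel i p k a b).
Proof.
have oU : open (cimg i) by exact: cimg_open.
apply: (CkM oU); first exact: Ck_cst.
apply: Ck_sum => // l _; apply: (CkM oU).
  by apply: Ck_invmx => //; [exact: gmx_unit|move=> c d; exact: Ck_gmx].
by apply: (CkB oU); [apply: (CkD oU)|]; apply: Ck_partial; exact: Ck_gmx.
Qed.

(** Differentiating [g (gradient, _) = d psi] along [v] expresses the derivative of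
    the gradient by second derivatives of [psi] and first derivatives of [g], and
    [christoffel_exchange] turns the latter into Christoffel symbols contracted with
    [d psi]. *)
Lemma hessian_coordinates i (psi : 'rV[R]_n -> R) (V : set 'rV[R]_n) p v :
  open V -> V p -> cimg i p -> Ck 2 V psi ->
  hessian i psi p v v =
  \sum_k \sum_l v 0 k * v 0 l * partial l (partial k psi) p -
  \sum_k christoffel_bilin i p v v 0 k * partial k psi p.
Proof.
move=> oV Vp Up Hpsi.
pose W := V `&` cimg i.
have oW : open W by apply: openI => //; exact: cimg_open.
have Wp : W p by [].
pose h q := gradient i psi q.
have Hh k : Ck 1 W (fun q => h q 0 k).
  apply: (@Ck_eq _ _ _ _ _ (fun q => \sum_l invmx (gmx i q) k l * partial l psi q)) => //.
    by move=> q _; rewrite mxE.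
  apply: Ck_sum => // l _; apply: (CkM oW).
    apply: (@Ck_sub _ _ _ _ (cimg i)); first exact: subIsetr.
    apply: Ck_invmx; [exact: cimg_open|exact: gmx_unit|by move=> c d; exact: Ck_gmx].
  by apply: (@Ck_sub _ _ _ _ V); [exact: subIsetl|exact: Ck_partial].
have gh q m : W q -> \sum_k gmx i q m k * h q 0 k = partial m psi q.
  move=> [_ Uq]; under eq_bigr do rewrite mxE mulr_sumr.
  rewrite exchange_big /=.
  under eq_bigr do (under eq_bigr do rewrite mulrA; rewrite -mulr_suml).
  have E l : \sum_k gmx i q m k * invmx (gmx i q) k l = (m == l)%:R.
    have := congr1 (fun A : 'M[R]_n => A m l) (mulmxV (gmx_unit Uq)).
    by rewrite !mxE.
  under eq_bigr do rewrite E.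
  by rewrite (bigD1 m) //= eqxx mul1r big1 ?addr0 // => l; rewrite eq_sym => /negPf ->; rewrite mul0r.
have dh k : derivable (fun q => h q 0 k) p v by apply: diff_derivable; case: (Hh k) => H _; exact: H.
have dgm a b : differentiable (fun q => gmx i q a b) p.
  by case: (@Ck_gmx 1 i a b) => H _; exact: H.
have hd : derivable h p v by apply/derivable_mxP => a k; rewrite (ord1 a).
pose dvh k := 'D_v (fun q => h q 0 k) p.
pose P a b c := partial a (fun q => gmx i q b c) p.
have Psym a b c : P a b c = P a c b.
  apply: near_eq_derive; apply: (open_near_eq oW) => // q [_ /gmx_symE E].
  by rewrite -{1}E mxE.
have key m : \sum_k (gmx i p m k * dvh k + h p 0 k * \sum_a v 0 a * P a m k) =
    \sum_l v 0 l * partial l (partial m psi) p.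
  rewrite -derive_partial; last by case: Hpsi => _ /(_ m)[H _]; exact: H.
  have E : \near p, (\sum_k ((fun q => gmx i q m k) * (fun q => h q 0 k))) p = partial m psi p.
    by apply: (open_near_eq oW) => // q Wq; rewrite fct_sumE -gh.
  rewrite -(near_eq_derive _ E).
  have dgv k : is_derive p v (fun q => gmx i q m k) ('D_v (fun q => gmx i q m k) p).
    exact/derivableP/diff_derivable.
  have dM k := is_deriveM (dgv k) (derivableP (dh k)).
  rewrite (@derive_val _ _ _ _ _ _ _ (is_derive_sum dM)).
  by apply: eq_bigr => k _; rewrite (derive_partial _ (dgm m k)).
transitivity (\sum_k (dvh k + christoffel_bilin i p v (h p) 0 k) *
    \sum_m gmx i p k m * v 0 m).
  rewrite /hessian bilinE; apply: eq_bigr => k _; rewrite mulr_sumr; apply: eq_bigr => m _.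
  by rewrite /nabla derive_mx // !mxE mulrA.
under eq_bigr do rewrite mulrDl; rewrite big_split /=.
have chE x y k : christoffel_bilin i p x y 0 k =
    \sum_a \sum_b (2^-1 * \sum_l invmx (gmx i p) k l * (P a b l + P b a l - P l a b)) *
      x 0 a * y 0 b by rewrite mxE.
under [X in _ + X]eq_bigr do rewrite chE.
rewrite (christoffel_exchange (gmx_symE Up) (mulmxV (gmx_unit Up)) Psym) addrA.
under [X in _ = _ - X]eq_bigr do rewrite chE -gh //.
congr (_ - _).
under [RHS]eq_bigr do (under eq_bigr do rewrite -mulrA; rewrite -mulr_sumr -key mulr_sumr).
under [RHS]eq_bigr do (under eq_bigr do rewrite mulrDr; rewrite big_split /=).
rewrite big_split /=; congr (_ + _).
  rewrite [RHS]exchange_big /=; apply: eq_bigr => k _; rewrite mulr_sumr.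
  apply: eq_bigr => m _; rewrite -{1}(gmx_symE Up) mxE; ring.
rewrite [LHS]exchange_big /=; apply: eq_bigr => b _.
rewrite exchange_big /=; apply: eq_bigr => c _.
by rewrite !mulr_sumr; apply: eq_bigr => a _; ring.
Qed.

End HessianFormula.

(** * Test functions and tangent vectors from a single chart *)

Lemma continuous_at_open (T S : topologicalType) (A : set T) (f : T -> S) x :
  open A -> {within A, continuous f} -> A x -> {for x, continuous f}.
Proof. by move=> oA; rewrite continuous_open_subspace // => fc Ax; apply: fc; rewrite inE. Qed.

Section Charts.
Context {R : realType} {n : nat} {M : smoothManifold R n}.
Implicit Types (i j : cindex M) (x y : M) (p q : 'rV[R]_n).

Lemma cmap_continuous_at i x : cdom i x -> {for x, continuous (cmap i)}.
Proof. by apply: continuous_at_open; [exact: cdom_open|exact: cmap_continuous]. Qed.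

Lemma cinv_continuous_at i p : (cmap i @` cdom i) p -> {for p, continuous (cinv i)}.
Proof. by apply: continuous_at_open; [exact: cimg_open|exact: cinv_continuous]. Qed.

Lemma cinvK i p : (cmap i @` cdom i) p -> cdom i (cinv i p) /\ cmap i (cinv i p) = p.
Proof. by move=> [x dx <-]; rewrite cmapK. Qed.

Lemma open_cmap_image i (O : set M) : open O -> open (cmap i @` (cdom i `&` O)).
Proof.
move=> oO; rewrite openE => _ [x [dx Ox] <-].
have px : (cmap i @` cdom i) (cmap i x) by exists x.
rewrite /interior /=; near=> q.
have Uq : (cmap i @` cdom i) q.
  by near: q; apply: open_nbhs_nbhs; split; [exact: cimg_open|].
have [dq qE] := cinvK Uq; exists (cinv i q) => //; split=> //.
by near: q; apply: (cinv_continuous_at px); rewrite cmapK //; exact: open_nbhs_nbhs.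
Unshelve. all: by end_near. Qed.

(** In another chart the function is [psi] composed with a transition map, where the
    two domains meet, and zero off the image [K] of the support. These two open sets
    cover the chart because [K] is compact, hence closed in a Hausdorff space. *)
Lemma chart_supported_C2 i (psi : 'rV[R]_n -> R) p (r : R) :
  (forall q, `|q - p| <= r -> (cmap i @` cdom i) q) ->
  Ck 2 (cmap i @` cdom i) psi -> (forall q, r < `|q - p| -> psi q = 0) ->
  C2_on setT (fun y : M => if `[< cdom i y >] then psi (cmap i y) else 0).
Proof.
move=> Bi Hpsi psi0 j; set phi := fun y : M => _.
pose K := cinv i @` [set q | `|q - p| <= r].
have cK : closed K.
  apply: compact_closed; first exact: m_hausdorff.
  apply: continuous_compact; last exact: compact_norm_ball.
  by apply: continuous_in_subspaceT => q; rewrite inE => /Bi /cinv_continuous_at.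
have oK : open (~` K) by exact: closed_openC.
have odi : open (cdom i) by exact: cdom_open.
have -> : cdom j `&` setT = cdom j `&` cdom i `|` cdom j `&` ~` K.
  rewrite setIT -setIUr; apply/seteqP; split=> [y dy|y []] //; split=> //.
  have [[q /Bi qi <-]|nKy] := pselect (K y); last by right.
  by left; case: (cinvK qi).
rewrite image_setU; apply: Ck_union.
- have H : Ck 2 (cmap j @` (cdom j `&` cdom i)) (psi \o (cmap i \o cinv j)).
    apply: (@Ck_comp _ _ _ _ _ (cmap i @` cdom i)) => //.
    + exact: open_cmap_image.
    + exact: cimg_open.
    + by move=> _ [y [dj di] <-]; exists y => //=; rewrite cmapK.
    + exact: transition_smooth.
  apply: Ck_eq H; first exact: open_cmap_image.
  by move=> _ [y [dj di] <-]; rewrite /phi /= cmapK //; case: asboolP.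
- apply: (@Ck_eq _ _ _ _ _ (cst 0)); [exact: open_cmap_image| |exact: Ck_cst].
  move=> _ [y [dj nKy] <-]; rewrite /phi /= cmapK //; case: asboolP => // di.
  rewrite psi0 // ltNge; apply/negP => yp; apply: nKy.
  by exists (cmap i y) => //; rewrite cmapK.
Qed.

Lemma transition_differentiable i j x : cdom i x -> cdom j x ->
  differentiable (transition i j) (cmap i x).
Proof.
move=> di dj; have H := transition_smooth i j 1.
by apply: (Ck_differentiable H); exists x.
Qed.

(** The components in the other charts are forced by those in one chart; they are
    coherent by the chain rule. *)
Lemma tangent_of_components i x (w : 'rV[R]_n) : cdom i x ->
  exists v : tangent x, components v i = w.
Proof.
move=> di.
have trans j k : cdom j x -> cdom k x ->
    'D_w (transition i k) (cmap i x) =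
    'D_('D_w (transition i j) (cmap i x)) (transition j k) (cmap j x).
  move=> dj dk.
  have E : transition i j (cmap i x) = cmap j x by rewrite /transition /= cmapK.
  rewrite -E -derive_comp; last first.
  - by rewrite E; exact: transition_differentiable.
  - exact: transition_differentiable.
  apply: near_eq_derive.
  have oU : open (cmap i @` (cdom i `&` cdom j)).
    by apply: open_cmap_image; exact: cdom_open.
  apply: (open_near_eq oU); last by exists x.
  by move=> _ [y [dy dy'] <-]; rewrite /transition /= !cmapK.
exists (Tangent trans) => /=.
rewrite -[RHS](derive_id (cmap i x) w).
apply: near_eq_derive.
have oU : open (cmap i @` cdom i) by exact: cimg_open.
apply: (open_near_eq oU); last by exists x.
by move=> _ [y dy <-]; rewrite /transition /= cmapK.
Qed.

End Charts.

(** * Convexity along geodesics *)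

Section Transfer.
Context {R : realType} {n : nat} {M : riemannianManifold R n}.
Implicit Types (i : cindex M) (x y : M) (p q : 'rV[R]_n).

Lemma partial2_near_eq (f g : 'rV[R]_n -> R) p k l :
  (\near p, f p = g p) ->
  partial k f p = partial k g p /\ partial l (partial k f) p = partial l (partial k g) p.
Proof.
move=> fg; split; first exact: near_eq_derive.
apply: near_eq_derive; have := near_join fg; apply: filterS => q.
exact: near_eq_derive.
Qed.

(** A local test function in one chart is as good as a test function on the manifold:
    a cut-off equal to 1 near [p] changes neither the touching nor the second order
    jet at [p]. *)
Lemma viscosity_in_chart (Om : set M) (f : M -> R) i (V : set 'rV[R]_n)
    (Phi : 'rV[R]_n -> R) p (w : 'rV[R]_n) :
  open Om ->
  (forall x : M, Om x ->
     forall (xi : tangent x -> R) (X : tangent x -> tangent x -> R),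
       superjet Om f (xi, X) -> forall v : tangent x, 0 <= X v v) ->
  open V -> V p -> (cmap i @` (cdom i `&` Om)) p -> Ck 2 V Phi ->
  (\forall q \near p, f (cinv i q) - Phi q <= f (cinv i p) - Phi p) ->
  0 <= \sum_k \sum_l w 0 k * w 0 l * partial l (partial k Phi) p -
       \sum_k christoffel_bilin i p w w 0 k * partial k Phi p.
Proof.
move=> oOm visc oV Vp [x [dx Ox] xp] HPhi touch.
have oU : open (cmap i @` cdom i) by exact: cimg_open.
have Up : (cmap i @` cdom i) p by exists x.
pose V' := V `&` (cmap i @` cdom i).
have oV' : open V' by exact: openI.
have /nbhs_ballP[r0 /= r00 Hr0] : nbhs p V' by exact: open_nbhs_nbhs.
pose r := r0 / 2.
have r_gt0 : 0 < r by rewrite divr_gt0.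
have Br q : `|q - p| <= r -> V' q.
  move=> qr; apply: Hr0; rewrite -ball_normE /= distrC (le_lt_trans qr) //.
  by rewrite /r; lra.
have [B [HB B1 B0]] := bump_exists p r_gt0.
pose psi q := B q * Phi q.
have psi0 q : r < `|q - p| -> psi q = 0 by move=> /ltW /B0; rewrite /psi => ->; rewrite mul0r.
have Hpsi : Ck 2 (cmap i @` cdom i) psi.
  pose far := [set q | r < `|q - p|].
  have ofar : open far.
    apply: (@open_comp _ _ (fun q => `|q - p|) [set t | r < t]); last exact: open_gt.
    move=> q _; exact: (cvg_norm (cvgB cvg_id (cvg_cst p))).
  apply: (@Ck_sub _ _ _ _ (V' `|` far)).
    by move=> q _; have [/Br|] := leP `|q - p| r; [left|right].
  apply: Ck_union.
    by apply: (CkM oV'); [exact: Ck_sub HB|apply: Ck_sub HPhi; exact: subIsetl].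
  by apply: (@Ck_eq _ _ _ _ _ (cst 0)) => // [q /psi0 ->//|]; exact: Ck_cst.
have BU q : `|q - p| <= r -> (cmap i @` cdom i) q by move=> /Br[].
have Hphi := chart_supported_C2 BU Hpsi psi0.
set phi := (fun y : M => _) in Hphi.
have psiPhi : \forall q \near p, psi q = Phi q.
  by near=> q; rewrite /psi (_ : B q = 1) ?mul1r //; near: q.
have phiPhi : \near p, (phi \o cinv i) p = Phi p.
  near=> q; have Uq : (cmap i @` cdom i) q by near: q; exact: open_nbhs_nbhs.
  have [dq qE] := cinvK Uq.
  rewrite /phi /=; case: asboolP => // _; rewrite qE; near: q; exact: psiPhi.
have cx : cmap i @ x --> p by rewrite -xp; exact: cmap_continuous_at.
have phix : phi x = Phi p.
  by have := nbhs_singleton phiPhi; rewrite /= -xp cmapK.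
have jet : superjet Om f (d1 i phi (x := x), d2 i phi (x := x)).
  exists setT, phi, i; split=> //.
  - exact: openT.
  - near=> y => Oy.
    have dy : cdom i y by near: y; apply: open_nbhs_nbhs; split => //; exact: cdom_open.
    have H1 : f (cinv i (cmap i y)) - Phi (cmap i y) <= f (cinv i p) - Phi p.
      by near: y; exact: (cx _ touch).
    have H2 : psi (cmap i y) = Phi (cmap i y) by near: y; exact: (cx _ psiPhi).
    rewrite phix /phi; case: asboolP => // _; rewrite H2.
    by move: H1; rewrite -xp !cmapK.
have [v vw] := tangent_of_components w dx.
have HU : Ck 2 (cmap i @` cdom i) (phi \o cinv i) by have := Hphi i; rewrite setIT.
have E1 k : partial k (phi \o cinv i) p = partial k Phi p.
  by have [-> _] := partial2_near_eq k k phiPhi.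
have E2 k l : partial l (partial k (phi \o cinv i)) p = partial l (partial k Phi) p.
  by have [_ ->] := partial2_near_eq k l phiPhi.
have <- : hessian i (phi \o cinv i) p w w =
    \sum_k \sum_l w 0 k * w 0 l * partial l (partial k Phi) p -
    \sum_k christoffel_bilin i p w w 0 k * partial k Phi p.
  have HC := hessian_coordinates w oU Up Up HU.
  have S1 : \sum_k \sum_l w 0 k * w 0 l * partial l (partial k (phi \o cinv i)) p =
      \sum_k \sum_l w 0 k * w 0 l * partial l (partial k Phi) p.
    by apply: eq_bigr => k _; apply: eq_bigr => l _; rewrite E2.
  have S2 : \sum_k christoffel_bilin i p w w 0 k * partial k (phi \o cinv i) p =
      \sum_k christoffel_bilin i p w w 0 k * partial k Phi p.
    by apply: eq_bigr => k _; rewrite E1.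
  exact: (etrans HC (congr2 (fun a b => a - b) S1 S2)).
by have := visc x Ox _ _ jet v; rewrite /d2 vw xp.
Unshelve. all: by end_near. Qed.

Lemma geodesic_convexity (Om : set M) (f : M -> R) :
  open Om -> {within Om, continuous f} ->
  (forall x : M, Om x ->
     forall (xi : tangent x -> R) (X : tangent x -> tangent x -> R),
       superjet Om f (xi, X) -> forall v : tangent x, 0 <= X v v) ->
  convex_on Om f.
Proof.
move=> oOm f_cont visc J c iJ [D [oD JD cc geo]] cJ.
have cf x : Om x -> {for x, continuous f} by move=> ?; exact: continuous_at_open f_cont _.
have cOm t : J t -> Om (c t) by move=> Jt; apply: cJ; exists t.
apply: convex_of_no_parabola => // [t Jt|x y t0 b e /andP[xt0 t0y] e0 H].
  by apply: continuous_comp; [exact/cc/JD|exact/cf/cOm].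
have Jt0 : J t0 by have [|//] := H t0; rewrite !ltW.
pose i := chart_at (c t0).
have di0 : cdom i (c t0) by exact: chart_atP.
have odi : open (cdom i) by exact: cdom_open.
have : \forall t \near t0, [/\ x <= t <= y, D t & cdom i (c t)].
  near=> t; split; last 2 first.
  - by near: t; apply: open_nbhs_nbhs; split=> //; exact: JD.
  - by near: t; apply: (cc _ (JD _ Jt0)); exact: open_nbhs_nbhs.
  apply/andP; split; apply: ltW; near: t; [exact: lt_nbhsr|exact: lt_nbhsl].
move=> /nbhs_ballP[d1 /= d10 Hd1].
pose d := d1 / 2.
have d0 : 0 < d by rewrite divr_gt0.
have {}Hd1 t : `|t - t0| <= d -> [/\ x <= t <= y, D t & cdom i (c t)].
  move=> td; apply: Hd1; rewrite -ball_normE /= distrC (le_lt_trans td) // /d.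
  by lra.
pose u := cmap i \o c; pose v := derive1 u.
pose G k a b p := @christoffel R n M i p k a b.
have du t : `|t - t0| <= d -> is_derive t 1 u (v t).
  move=> /Hd1[_ Ot dt]; have [Hu _ _] := geo t i Ot dt.
  by rewrite /v derive1E; exact: derivableP.
have dv t : `|t - t0| <= d -> is_derive t 1 v (- quadratic_field G (u t) (v t)).
  move=> /Hd1[_ Ot dt]; have [_ Hv E] := geo t i Ot dt.
  have := derivableP Hv; rewrite -derive1E => H1; apply: is_derive_eq H1 _.
  by apply/eqP; rewrite -addr_eq0; apply/eqP.
have uE t : `|t - t0| <= d -> cinv i (u t) = c t.
  by move=> /Hd1[_ _ dt]; rewrite /u /= cmapK.
have t0d : `|t0 - t0| <= d by rewrite subrr normr0 ltW.
have oU : open (cmap i @` cdom i) by exact: cimg_open.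
have Uu t : `|t - t0| <= d -> (cmap i @` cdom i) (u t).
  by move=> /Hd1[_ _ dt]; exists (c t).
have HG k a b' : Ck 1 (cmap i @` cdom i) (G k a b') by exact: Ck_christoffel.
have touch t : `|t - t0| <= d -> f (c t) - f (c t0) <= b * (t - t0) - e * (t - t0) ^+ 2.
  by move=> /Hd1[xty _ _]; have [] := H t xty.
(* A geodesic at rest at [t0] is constant nearby, and no constant function is touched
   by a strictly concave parabola at an interior point. *)
have [v0|v0] := eqVneq (v t0) 0.
  have cGu (kab : 'I_n * 'I_n * 'I_n) :
      {for t0, continuous (fun t => G kab.1.1 kab.1.2 kab.2 (u t))}.
    have cu := is_derive_vec_continuous (du _ t0d).
    exact: (continuous_comp cu (Ck_continuous (HG _ _ _) (Uu _ t0d))).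
  have [C C0 /nbhs_ballP[d2 /= d20 Hd2]] := finite_locally_bounded cGu.
  pose d3 := Num.min d (d2 / 2).
  have d30 : 0 < d3 by rewrite lt_min d0 divr_gt0.
  have d3d t : `|t - t0| <= d3 -> `|t - t0| <= d.
    by move=> /le_trans; apply; rewrite ge_min lexx.
  have [|||d4 /andP[d40 d43] vz] := @rest_of_quadratic_acceleration R n v
    (fun t => - quadratic_field G (u t) (v t)) t0 d3 (n%:R * (n%:R * C)) d30.
  - by move=> t /d3d /dv.
  - move=> t td3; rewrite normrN.
    have HC : forall kab : 'I_n * 'I_n * 'I_n, `|G kab.1.1 kab.1.2 kab.2 (u t)| <= C.
      apply: Hd2; rewrite -ball_normE /= distrC (le_lt_trans td3) //.
      by rewrite gt_min; apply/orP; right; lra.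
    apply: row_norm_le => [|k]; first by rewrite !mulr_ge0 // ltW.
    rewrite mxE -[leRHS]mulrA -[X in _ * X]mulrA; apply: ler_norm_sum_const => a.
    apply: ler_norm_sum_const => a'; rewrite expr2 [leRHS]mulrA.
    rewrite (normrM (G k a a' (u t) * v t 0 a)) (normrM (G k a a' (u t))).
    apply: ler_pM; rewrite ?mulr_ge0 //; last exact: coord_norm_le.
    by apply: ler_pM => //; [exact: (HC (k, a, a'))|exact: coord_norm_le].
  - exact: v0.
  have uconst := constant_of_zero_velocity d40
    (fun t td => du t (d3d t (le_trans td d43))) vz.
  apply: (@no_constant_touching R (f \o c) t0 d4 b e d40 e0) => t td /=.
  have td' := d3d t (le_trans td d43); split; last exact: touch.
  by rewrite -(uE _ td') -(uE _ t0d) uconst.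
pose W := cmap i @` (cdom i `&` Om).
have oW : open W by exact: open_cmap_image.
have WU : W `<=` cmap i @` cdom i by move=> _ [z [dz _] <-]; exists z.
have [||||V [Phi [p [w [oV [Vp [Wp _]] HPhi tch neg]]]]] :=
  @touching_geodesic R n W G u v (f \o cinv i) t0 d b e 1 oW _ d0 _ v0 _ e0 _ ltr01.
- by move=> k a b'; exact: Ck_sub (HG k a b').
- move=> t /ltW td; have [xty Ot dt] := Hd1 _ td; split; [|exact: du|exact: dv].
  by exists (c t) => //; split=> //; have [/cOm] := H t xty.
- move=> p Wp; have ci := cinv_continuous_at (WU _ Wp).
  have Op : Om (cinv i p) by case: Wp => z [dz Oz] <-; rewrite cmapK.
  exact: (continuous_comp ci (cf _ Op)).
- by move=> t /ltW td; rewrite /= (uE _ td) (uE _ t0d); exact: touch.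
have := viscosity_in_chart w oOm visc oV Vp Wp HPhi tch.
by move: neg; rewrite ltNge => /negP.
Unshelve. all: by end_near. Qed.

End Transfer.

Unset Implicit Arguments.
Set Strict Implicit.
Set Printing Implicit Defensive.

Theorem theorem3p9 (R : realType) (n : nat) (M : riemannianManifold R n)
    (M_complete : complete_manifold M)
    (M_curv : positive_sectional_curvature M)
    (Om : set M) (Om_open : open Om) (Om_convex : convex_subset Om)
    (f : M -> R) (f_cont : {within Om, continuous f})
    (f_visc : forall x : M, Om x ->
       forall (xi : tangent x -> R) (X : tangent x -> tangent x -> R),
         superjet Om f (xi, X) -> forall v : tangent x, 0 <= X v v) :
  convex_on Om f.
Proof. exact: geodesic_convexity. Qed.
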